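(* Let $p$ be a prime and $G=S^1\times C_p$. For every integer $n\ge 1$ there exist an integer $m\ge n$ and a continuous $G$-equivariant map $f_n:S(V_n)\to S(W_m)$.
   Context: $S^1=\{t\in\mathbb{C}:|t|=1\}$, $C_p$ is cyclic of prime order $p$ with generator $a$, and elements of $G=S^1\times C_p$ are written $ta^i$. Let $\xi_p=\exp(2\pi\sqrt{-1}/p)$. For $k\in\mathbb{Z}$ and $l\in\mathbb{Z}/p$, $V_{k,l}$ is the one-dimensional complex (unitary) $G$-representation with underlying space $\mathbb{C}$ and action $t\cdot z=t^kz$, $a\cdot z=\xi_p^l z$. For $n,m\ge1$ set $V_n=V_{1,1}\oplus V_{p,1}\oplus\cdots\oplus V_{p^{n-1},1}$ (real dimension $2n$) and $W_m=V_{p^m,0}\oplus V_{0,1}$ (real dimension $4$). $S(V)$ denotes the unit sphere of a representation $V$. *)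

(* Defs.v *)
From HB Require Import structures.
From mathcomp Require Import all_boot all_order all_algebra.
From mathcomp Require Import reals trigo.
Set Implicit Arguments. Unset Strict Implicit. Unset Printing Implicit Defensive.
Import Order.TTheory GRing.Theory Num.Theory.
Local Open Scope ring_scope.

Section Defs.
Variable R : realType.

Definition cpx := (R * R)%type.
Definition cmul (a b : cpx) : cpx :=
  (a.1 * b.1 - a.2 * b.2, a.1 * b.2 + a.2 * b.1).
Definition cnorm2 (a : cpx) : R := a.1 ^+ 2 + a.2 ^+ 2.
Definition cexp (a : cpx) (k : nat) : cpx := iter k (cmul a) (1, 0).
Definition xi (p : nat) : cpx := (cos (2 * pi / p%:R), sin (2 * pi / p%:R)).

(* action of the group element t a^i (|t| = 1) on V_{k,l}: z |-> t^k xi_p^(l i) z *)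
Definition rho (p k l : nat) (t : cpx) (i : nat) (z : cpx) : cpx :=
  cmul (cmul (cexp t k) (cexp (xi p) (l * i))) z.

Definition repact (p d : nat) (w : 'I_d -> nat * nat) (t : cpx) (i : nat)
  (v : 'I_d -> cpx) : 'I_d -> cpx :=
  fun j => rho p (w j).1 (w j).2 t i (v j).

(* V_n = V_{1,1} + V_{p,1} + ... + V_{p^(n-1),1} *)
Definition wV (p n : nat) : 'I_n -> nat * nat := fun j => ((p ^ val j)%N, 1%N).
(* W_m = V_{p^m,0} + V_{0,1} *)
Definition wW (p m : nat) : 'I_2 -> nat * nat :=
  fun j => if val j == 0%N then ((p ^ m)%N, 0%N) else (0%N, 1%N).

Definition vnorm2 (d : nat) (v : 'I_d -> cpx) : R := \sum_(j < d) cnorm2 (v j).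
Definition vdist2 (d : nat) (u v : 'I_d -> cpx) : R :=
  \sum_(j < d) cnorm2 ((u j).1 - (v j).1, (u j).2 - (v j).2).
Definition in_sphere (d : nat) (v : 'I_d -> cpx) : Prop := vnorm2 v = 1.

Definition sphere_continuous (d e : nat) (f : ('I_d -> cpx) -> ('I_e -> cpx)) : Prop :=
  forall v, in_sphere v -> forall eps : R, 0 < eps ->
    exists2 del : R, 0 < del & forall u, in_sphere u ->
      vdist2 u v < del -> vdist2 (f u) (f v) < eps.

End Defs.
Arguments wV : clear implicits.
Arguments wW : clear implicits.

(* Main.v *)
Require Import Defs.
From HB Require Import structures.
From mathcomp Require Import all_boot all_order all_algebra.
From mathcomp Require Import reals trigo.
From mathcomp Require Import boolp classical_sets topology normedtype.
From mathcomp Require Import ring complex.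
Import Order.TTheory GRing.Theory Num.Theory.
Import numFieldNormedType.Exports.
Local Open Scope ring_scope.
Set Implicit Arguments. Unset Strict Implicit. Unset Printing Implicit Defensive.

(* Write a point of [C^2] minus the origin as a quaternion [q = q.1 + q.2 j].
   The map [hmap q = (q.1, q.2^(p+1))] is a G-map of [S(W_m)], and
   [amap q = (q.1^p, q.2)] is a G-map from [S(W_m)] to [S(W_(m+1))].  Let [Z_m]
   be the space of paths [g] in [S(W_m)] with [g 1 = hmap (g 0)].  We construct
   by induction on [n] a G-map from [S(V_n)] to some [Z_m]; evaluation at [0]
   gives the map of the theorem.

   The key point is that composition with [amap \o amap] is null-homotopic on
   [Z_m], naturally but not equivariantly ([contract] below).  Indeed [amap] is
   homotopic to [hmap q * q^-1] (both have degree [p]), hence a path [g] in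
   [Z_m] yields a path [eta] from [1] to [amap (g 0)].  Sliding along [eta]
   deforms [amap \o g] into a loop [l] at [1]; then [amap \o l] is deformed into
   [hmap (l t) * (l t)^-1], which is contracted inside [Z_m] through the paths
   [t |-> hmap (l (s t)) * (l (s t))^-1 * l s].

   Since [V_(n+1) = V_(1,1) + (pull-back of V_n under t |-> t^p)], a point
   [(x, y)] with [x <> 0] can be rotated to [x > 0], with stabiliser [C_p] acting
   on [y] by scalars, hence freely.  The null-homotopy is made [C_p]-equivariant
   by applying its conjugates one after the other, each one over a part of the
   sphere on which an element of [C_p] can be chosen continuously and
   equivariantly; this uses up a fresh pair of factors [amap] each time.  The
   resulting homotopy, run with a parameter growing with [|x| / |y|], extends
   the given map on [x = 0] over the whole sphere of [V_(n+1)]. *)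

(** * Quaternions and the clamp function *)

Section Quaternion.
Variable C : numClosedFieldType.
Implicit Types (q r : C * C) (z : C).

(* The pair [(z, w)] is the quaternion [z + w j]. *)
Definition qmul q r : C * C :=
  (q.1 * r.1 - q.2 * r.2^*, q.1 * r.2 + q.2 * r.1^*).
Definition qnorm q : C := q.1 * q.1^* + q.2 * q.2^*.
Definition qinv q : C * C := (q.1^* / qnorm q, - q.2 / qnorm q).
Definition qone : C * C := (1, 0).

Lemma qnormE q : qnorm q = `|q.1| ^+ 2 + `|q.2| ^+ 2.
Proof. by rewrite /qnorm !normCK. Qed.

Lemma qnorm_ge0 q : 0 <= qnorm q.
Proof. by rewrite qnormE addr_ge0 // exprn_ge0. Qed.

Lemma conj_qnorm q : (qnorm q)^* = qnorm q.
Proof. by apply/CrealP; apply: ger0_real; exact: qnorm_ge0. Qed.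

Lemma qnorm_eq0 q : (qnorm q == 0) = (q.1 == 0) && (q.2 == 0).
Proof. by rewrite qnormE paddr_eq0 ?exprn_ge0 // !expf_eq0 /= !normr_eq0. Qed.

Lemma qmulA q r s : qmul q (qmul r s) = qmul (qmul q r) s.
Proof.
case: q r s => [a b] [c d] [e f]; rewrite /qmul /=.
by congr pair; rewrite ?(rmorphB, rmorphD, rmorphM, conjCK) /=; rewrite ?conjCK; ring.
Qed.

Lemma qmul1q q : qmul qone q = q.
Proof. by case: q => a b; rewrite /qmul /= !mul0r !mul1r subr0 addr0. Qed.

Lemma qmulq1 q : qmul q qone = q.
Proof.
by case: q => a b; rewrite /qmul /= conjC0 conjC1 !mulr0 !mulr1 subr0 add0r.
Qed.

Lemma qmulqV q : qnorm q != 0 -> qmul q (qinv q) = qone.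
Proof.
move=> q0; rewrite /qmul /qinv /= !(rmorphM, rmorphN, fmorphV) /= conj_qnorm conjCK.
congr pair; last by ring.
rewrite -[RHS](divff q0) {3}/qnorm; ring.
Qed.

Lemma qmulVq q : qnorm q != 0 -> qmul (qinv q) q = qone.
Proof.
move=> q0; rewrite /qmul /qinv /=.
congr pair; last by ring.
rewrite -[RHS](divff q0) {3}/qnorm; ring.
Qed.

Lemma qmulKV q r : qnorm q != 0 -> qmul (qmul r (qinv q)) q = r.
Proof. by move=> q0; rewrite -qmulA qmulVq // qmulq1. Qed.

Lemma qinv1 : qinv qone = qone.
Proof. by rewrite /qinv /qnorm /= conjC1 conjC0 mulr1 mulr0 addr0 divr1 oppr0 mul0r. Qed.

Lemma qnormM q r : qnorm (qmul q r) = qnorm q * qnorm r.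
Proof.
rewrite /qnorm /qmul /= !(rmorphB, rmorphD, rmorphM) /= !conjCK; ring.
Qed.

Lemma qnorm1 : qnorm qone = 1.
Proof. by rewrite /qnorm /= conjC1 conjC0 mulr1 mulr0 addr0. Qed.

Lemma qnormV q : qnorm q != 0 -> qnorm (qinv q) = (qnorm q)^-1.
Proof.
move=> q0; apply: (mulfI q0).
by rewrite -qnormM qmulqV // qnorm1 divff.
Qed.

Lemma qnormM_neq0 q r : qnorm q != 0 -> qnorm r != 0 -> qnorm (qmul q r) != 0.
Proof. by move=> *; rewrite qnormM mulf_neq0. Qed.

Lemma qnormV_neq0 q : qnorm q != 0 -> qnorm (qinv q) != 0.
Proof. by move=> q0; rewrite qnormV // invr_neq0. Qed.

End Quaternion.
Arguments qone : clear implicits.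

(** * Truncation of real parts, used as the clock of staged homotopies *)

Section Clamp.
Variable C : numClosedFieldType.
Implicit Type z : C.

(** Real numbers are taken as elements of [C], so the positive part is built from ['Re] and the
    modulus; it is thereby total on [C] and continuous. *)
Definition pospart z : C := ('Re z + `|'Re z|) / 2.
Definition clamp z : C := pospart z - pospart (z - 1).

Lemma pospart_ge0 z : 0 <= pospart z.
Proof.
rewrite /pospart divr_ge0 //.
by case/real_ge0P: (Creal_Re z) => z0; [rewrite addr_ge0 | rewrite subrr].
Qed.

Lemma pospart_le0 z : 'Re z <= 0 -> pospart z = 0.
Proof. by move=> z0; rewrite /pospart ler0_norm // subrr mul0r. Qed.

Lemma pospart_ge z : 0 <= 'Re z -> pospart z = 'Re z.
Proof. by move=> z0; rewrite /pospart ger0_norm //; field. Qed.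

Lemma pospart_neq0 z : (pospart z != 0) = (0 < 'Re z).
Proof.
have [z0|z0] := real_ltP (real0 C) (Creal_Re z); last by rewrite pospart_le0 // eqxx.
by rewrite pospart_ge ?(ltW z0) // gt_eqF.
Qed.

Lemma Re_sub1 z : 'Re (z - 1) = 'Re z - 1.
Proof. by rewrite raddfB /= [X in _ - X](Creal_ReP _ _) // real1. Qed.

Lemma clamp_le0 z : 'Re z <= 0 -> clamp z = 0.
Proof.
move=> z0; rewrite /clamp !pospart_le0 ?subrr // Re_sub1.
by rewrite subr_le0 (le_trans z0).
Qed.

Lemma clamp_ge1 z : 1 <= 'Re z -> clamp z = 1.
Proof.
move=> z1; rewrite /clamp !pospart_ge ?Re_sub1 ?subr_ge0 //; first by ring.
exact: le_trans z1.
Qed.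

Lemma clamp_bounds z : 0 <= clamp z <= 1.
Proof.
have [z0|z0] := real_leP (Creal_Re z) (real0 C); first by rewrite clamp_le0 // lexx ler01.
have [z1|z1] := real_leP (real1 C) (Creal_Re z); first by rewrite clamp_ge1 // ler01 lexx.
rewrite /clamp pospart_ge ?(ltW z0) // pospart_le0 ?Re_sub1 ?subr_le0 ?(ltW z1) //.
by rewrite subr0 !ltW.
Qed.

Lemma clamp_ge0 z : 0 <= clamp z.
Proof. by case/andP: (clamp_bounds z). Qed.

Lemma clamp_le1 z : clamp z <= 1.
Proof. by case/andP: (clamp_bounds z). Qed.

(** This separates consecutive stages: when the stage with clock [clamp (z - 1)] has begun, the
    preceding one is finished. *)
Lemma clamp_pred_neq0 z : clamp (z - 1) != 0 -> clamp z = 1.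
Proof.
move=> h; apply: clamp_ge1; rewrite -subr_ge0 -Re_sub1.
have [//|/ltW/clamp_le0 e] := real_leP (real0 C) (Creal_Re (z - 1)).
by rewrite e eqxx in h.
Qed.

End Clamp.

(** * Two self-maps of the sphere and a homotopy *)

Section SelfMaps.
Variables (C : numClosedFieldType) (p : nat) (xi : C).
Implicit Types (q r : C * C) (s z : C).

Definition amap q : C * C := (q.1 ^+ p, q.2).
Definition hmap q : C * C := (q.1, q.2 ^+ p.+1).
Definition kmap q := qmul (hmap q) (qinv q).

Lemma amap_hmap q : amap (hmap q) = hmap (amap q).
Proof. by []. Qed.

Lemma hmap_neq0 q : qnorm q != 0 -> qnorm (hmap q) != 0.
Proof. by rewrite !qnorm_eq0 /hmap /= expf_eq0. Qed.

Lemma hmap1 : hmap (qone C) = qone C.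
Proof. by rewrite /hmap /= expr0n. Qed.

Lemma amap1 : amap (qone C) = qone C.
Proof. by rewrite /amap /= expr1n. Qed.

Hypothesis p_gt0 : (0 < p)%N.

Lemma amap_neq0 q : qnorm q != 0 -> qnorm (amap q) != 0.
Proof. by rewrite !qnorm_eq0 /amap /= expf_eq0 p_gt0. Qed.

(* Five consecutive deformations, the [i]-th one being run by [clamp (s - i)].
   Whenever the second coordinate is moved, its zeros lie where [q.1 = 0],
   or where [q.2 ^+ p >= 0] and hence the first coordinate is positive. *)
Definition homot0 s q : C * C :=
  let x1 := clamp s in let x2 := clamp (s - 1) in
  let x3 := clamp (s - 1 - 1) in let x4 := clamp (s - 1 - 1 - 1) in
  let x5 := clamp (s - 1 - 1 - 1 - 1) in
  let X := (1 - x1) * q.1 + x1 * q.2 in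
  let Y := x1 * xi * q.1 + (1 - x1) * q.2 in
  let D := q.1 * q.1^* + q.2 * q.2^* * q.2 ^+ p in
  let l := 1 - x5 + x5 / qnorm q in
  (((1 - x2) * X ^+ p + x2 * D) * l,
   ((1 - x3) * Y + x3 * (q.1 * q.2 * (x4 * q.2 ^+ p - 1))) * l).

Lemma homot0_0 q : homot0 0 q = amap q.
Proof.
have E z : 'Re z <= 0 -> 'Re (z - 1) <= 0.
  by move=> z0; rewrite Re_sub1 subr_le0 (le_trans z0).
have R0 : 'Re (0 : C) <= 0 by rewrite raddf0.
rewrite /homot0 (clamp_le0 R0) (clamp_le0 (E _ R0)) (clamp_le0 (E _ (E _ R0))).
rewrite (clamp_le0 (E _ (E _ (E _ R0)))) (clamp_le0 (E _ (E _ (E _ (E _ R0))))) /amap.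
by rewrite !mul0r !subr0 !mul1r !addr0 !mulr1 add0r.
Qed.

Lemma homot0_5 q : qnorm q != 0 -> homot0 5 q = kmap q.
Proof.
move=> q0.
have -> : (5 : C) = 0 + 1 + 1 + 1 + 1 + 1 by ring.
have R0 : 0 <= 'Re (0 : C) by rewrite raddf0.
have E z : 0 <= 'Re z -> 1 <= 'Re (z + 1).
  by move=> z0; rewrite raddfD /= [X in _ + X](Creal_ReP _ (real1 C)) lerDr.
have E' z : 0 <= 'Re z -> 0 <= 'Re (z + 1) by move=> /E; apply: le_trans.
rewrite /homot0 !addrK (clamp_ge1 (E _ R0)) (clamp_ge1 (E _ (E' _ R0))).
rewrite (clamp_ge1 (E _ (E' _ (E' _ R0)))) (clamp_ge1 (E _ (E' _ (E' _ (E' _ R0))))).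
rewrite (clamp_ge1 (E _ (E' _ (E' _ (E' _ (E' _ R0)))))).
rewrite /kmap /qmul /hmap /qinv /= !(rmorphM, rmorphN, fmorphV) /= conj_qnorm conjCK.
by rewrite exprS; congr pair; field.
Qed.

Hypothesis xiP : xi ^+ p = 1.
Hypothesis xi1 : xi != 1.

(** The cases follow the latest stage that has begun: stages 3 to 5 together, then stage 2, then
    stage 1. The rescaling [l] of stage 5 is positive and drops out at once. *)
Lemma homot0_neq0 s q : qnorm q != 0 -> qnorm (homot0 s q) != 0.
Proof.
move=> q0; rewrite qnorm_eq0 /homot0 /=.
set x1 := clamp s; set x2 := clamp (s - 1); set x3 := clamp (s - 1 - 1).
set x4 := clamp (s - 1 - 1 - 1); set x5 := clamp _.
set D := _ + _ * _; set l := 1 - x5 + _.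
have l0 : l != 0.
  have [/eqP x50|x50] := boolP (x5 == 0); first by rewrite /l x50 mul0r subr0 addr0 oner_eq0.
  rewrite /l gt_eqF // ltr_wpDl ?subr_ge0 ?clamp_le1 //.
  by rewrite divr_gt0 // lt0r ?x50 ?clamp_ge0 ?q0 ?qnorm_ge0.
rewrite !mulf_eq0 (negPf l0) !orbF.
have D0 : q.1 != 0 -> 0 <= q.2 ^+ p -> D != 0.
  move=> q10 q2; rewrite /D -!normCK gt_eqF // ltr_pwDl ?exprn_gt0 ?normr_gt0 //.
  by rewrite mulr_ge0 // exprn_ge0.
apply: contra q0 => /andP[/eqP F /eqP S]; rewrite qnorm_eq0.
have xi0 : xi != 0.
  by apply: contra_eq_neq xiP => ->; rewrite expr0n gtn_eqF // eq_sym oner_eq0.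
(* From stage 3 on the first coordinate is [D]. If [q.1 = 0], then [D = 0] forces [q.2 = 0]; if not,
   a zero of the second coordinate forces [0 <= q.2 ^+ p], hence [D != 0]. *)
have [x30|x30] := eqVneq x3 0; last first.
  have x21 : x2 = 1 by exact: clamp_pred_neq0.
  have x11 : x1 = 1 by apply: clamp_pred_neq0; rewrite -/x2 x21 oner_eq0.
  move: F S; rewrite x21 x11 subrr mul0r add0r mul1r mul1r mul0r addr0 => F S.
  have [q10|q10] := eqVneq q.1 0.
    move: F; rewrite /D q10 mul0r add0r -normCK => /eqP.
    by rewrite mulf_eq0 !expf_eq0 /= normr_eq0 p_gt0 => /orP[].
  have {}S : (1 - x3) * xi + x3 * (q.2 * (x4 * q.2 ^+ p - 1)) = 0.
    by apply: (mulfI q10); rewrite mulr0 -[RHS]S; ring.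
  suff q2_ge0 : 0 <= q.2 ^+ p by move: (D0 q10 q2_ge0); rewrite F eqxx.
  (* During stage 3, [q.2] is a nonnegative multiple of [xi], whose [p]-th power is 1. Later, either
     [q.2 = 0] or [x4 * q.2 ^+ p = 1]. *)
  have [x40|x40] := eqVneq x4 0.
    have -> : q.2 = (1 - x3) / x3 * xi.
      apply: (mulfI x30); move/eqP: S; rewrite x40 mul0r sub0r mulrN1 mulrN subr_eq0 => /eqP <-.
      by field.
    rewrite exprMn xiP mulr1 exprn_ge0 // divr_ge0 ?clamp_ge0 //.
    by rewrite subr_ge0 clamp_le1.
  have x31 : x3 = 1 by exact: clamp_pred_neq0.
  move/eqP: S; rewrite x31 subrr mul0r add0r mul1r mulf_eq0 subr_eq0 => /orP[/eqP->|/eqP e].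
    by rewrite expr0n gtn_eqF.
  have -> : q.2 ^+ p = x4^-1 by apply: (mulfI x40); rewrite e divff.
  by rewrite invr_ge0 clamp_ge0.
move: S; rewrite x30 subr0 mul1r mul0r addr0 => S.
(* In stage 2 the second coordinate is [xi * q.1]; where [q.1 = 0] and [q.2 != 0], the first one is
   a positive multiple of [q.2 ^+ p]. *)
have [x20|x20] := eqVneq x2 0; last first.
  have x11 : x1 = 1 by exact: clamp_pred_neq0.
  move: F S; rewrite x11 subrr !mul0r add0r !mul1r addr0 => F /eqP.
  rewrite mulf_eq0 (negPf xi0) /= => q10; rewrite q10 /=.
  move: F; rewrite /D (eqP q10) mul0r add0r -normCK.
  have -> : (1 - x2) * q.2 ^+ p + x2 * (`|q.2| ^+ 2 * q.2 ^+ p) =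
            (1 - x2 + x2 * `|q.2| ^+ 2) * q.2 ^+ p by ring.
  have [//|q20] := eqVneq q.2 0.
  move/eqP; rewrite mulf_eq0 expf_eq0 (negPf q20) andbF orbF gt_eqF //.
  rewrite ltr_wpDl ?subr_ge0 ?clamp_le1 // mulr_gt0 ?exprn_gt0 ?normr_gt0 //.
  by rewrite lt0r x20 clamp_ge0.
move: F; rewrite x20 subr0 mul1r mul0r addr0 => /eqP; rewrite expf_eq0 p_gt0 /= => /eqP F.
(* In stage 1, [(X, Y)] is linear in [q] with this determinant. Were it zero, [xi] would be the
   square of a nonnegative number, and 1 is the only nonnegative [p]-th root of unity. *)
have [d0|d0] := eqVneq ((1 - x1) ^+ 2 - x1 ^+ 2 * xi) 0; last first.
  apply/andP; split; rewrite -(mulrI_eq0 _ (mulfI d0)).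
    have -> : ((1 - x1) ^+ 2 - x1 ^+ 2 * xi) * q.1 = (1 - x1) * 0 - x1 * 0; last by rewrite !mulr0 subrr.
    by rewrite -{1}F -S; ring.
  have -> : ((1 - x1) ^+ 2 - x1 ^+ 2 * xi) * q.2 = (1 - x1) * 0 - x1 * xi * 0; last by rewrite !mulr0 subrr.
  by rewrite -{1}S -F; ring.
case/eqP: xi1.
have [x10|x10] := eqVneq x1 0.
  by move/eqP: d0; rewrite x10 subr0 expr1n expr0n /= mul0r subr0 oner_eq0.
have xi_ge0 : 0 <= xi.
  have -> : xi = ((1 - x1) / x1) ^+ 2.
    apply: (mulfI (expf_neq0 2 x10)); move/eqP: d0; rewrite subr_eq0 => /eqP <-.
    by field.
  by rewrite exprn_ge0 // divr_ge0 ?clamp_ge0 // subr_ge0 clamp_le1.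
by apply/eqP; rewrite -(@pexpr_eq1 _ xi p) ?xiP.
Qed.

(* The right factor makes the homotopy constant at the base point. *)
Definition homot s q := qmul (homot0 (5 * s) q) (qinv (homot0 (5 * s) (qone C))).

Lemma qone_neq0 : qnorm (qone C) != 0.
Proof. by rewrite qnorm1 oner_eq0. Qed.

Lemma homot_neq0 s q : qnorm q != 0 -> qnorm (homot s q) != 0.
Proof.
by move=> q0; rewrite qnormM_neq0 ?qnormV_neq0 ?homot0_neq0 // qone_neq0.
Qed.

Lemma homot_one s : homot s (qone C) = qone C.
Proof. by rewrite /homot qmulqV // homot0_neq0 // qone_neq0. Qed.

Lemma homot_0 q : homot 0 q = amap q.
Proof. by rewrite /homot mulr0 !homot0_0 amap1 qinv1 qmulq1. Qed.

Lemma homot_1 q : qnorm q != 0 -> homot 1 q = kmap q.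
Proof.
move=> q0; rewrite /homot mulr1 !homot0_5 ?qone_neq0 //.
by rewrite {2}/kmap hmap1 qmulqV ?qone_neq0 // qinv1 qmulq1.
Qed.

End SelfMaps.

(** * The contraction of twisted paths *)

Section Convergence.
Local Open Scope classical_set_scope.
Variables (C : numClosedFieldType) (T : Type) (F : set_system T).
Context {FF : Filter F}.
Implicit Types (f g : T -> C) (a b : C) (q r : T -> C * C) (x y : C * C).

Lemma cvg_conj f a : f @ F --> a -> (fun t => (f t)^*) @ F --> a^*.
Proof.
move=> fa; apply/cvgrPdist_lt => e e0; move/cvgrPdist_lt: fa => /(_ e e0).
by apply: filterS => t; rewrite -rmorphB norm_conjC.
Qed.

Lemma cvgX f a n : f @ F --> a -> (fun t => f t ^+ n) @ F --> a ^+ n.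
Proof.
move=> fa; elim: n => [|n IHn]; first by under eq_fun do rewrite expr0; rewrite expr0; apply: cvg_cst.
by under eq_fun do rewrite exprS; rewrite exprS; apply: cvgM.
Qed.

Lemma cvg_Re f a : f @ F --> a -> (fun t => 'Re (f t)) @ F --> 'Re a.
Proof.
move=> fa; under eq_fun do rewrite ReE; rewrite ReE.
by apply: cvgM; [apply: cvgD => //; apply: cvg_conj | apply: cvg_cst].
Qed.

Lemma cvg_pospart f a : f @ F --> a -> (fun t => pospart (f t)) @ F --> pospart a.
Proof.
move=> fa; apply: cvgM; last exact: cvg_cst.
by apply: cvgD; [exact: cvg_Re | apply: cvg_norm; exact: cvg_Re].
Qed.

Lemma cvg_clamp f a : f @ F --> a -> (fun t => clamp (f t)) @ F --> clamp a.
Proof.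
move=> fa; apply: cvgB; apply: cvg_pospart => //.
by apply: cvgB => //; apply: cvg_cst.
Qed.

Definition qcvg q x := (fun t => (q t).1) @ F --> x.1 /\ (fun t => (q t).2) @ F --> x.2.

Lemma qcvg_cst x : qcvg (fun=> x) x.
Proof. by split; apply: cvg_cst. Qed.

Lemma qcvgM q r x y : qcvg q x -> qcvg r y -> qcvg (fun t => qmul (q t) (r t)) (qmul x y).
Proof.
move=> [q1 q2] [r1 r2]; split; rewrite /qmul /=; first by apply: cvgB; apply: cvgM => //; apply: cvg_conj.
by apply: cvgD; apply: cvgM => //; apply: cvg_conj.
Qed.

Lemma cvg_qnorm q x : qcvg q x -> (fun t => qnorm (q t)) @ F --> qnorm x.
Proof. by move=> [q1 q2]; apply: cvgD; apply: cvgM => //; apply: cvg_conj. Qed.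

Lemma qcvgV q x : qnorm x != 0 -> qcvg q x -> qcvg (fun t => qinv (q t)) (qinv x).
Proof.
move=> x0 qx; have := cvgV x0 (cvg_qnorm qx); case: qx => [q1 q2] n.
split; rewrite /qinv /=; apply: cvgM; [exact: cvg_conj | exact: n | exact: (cvgN q2) | exact: n].
Qed.

Lemma qcvg_hmap p q x : qcvg q x -> qcvg (fun t => hmap p (q t)) (hmap p x).
Proof. by move=> [q1 q2]; split => //; apply: cvgX. Qed.

Lemma qcvg_amap p q x : qcvg q x -> qcvg (fun t => amap p (q t)) (amap p x).
Proof. by move=> [q1 q2]; split => //; apply: cvgX. Qed.

Lemma cvg_sub1 f a : f @ F --> a -> (fun t => f t - 1) @ F --> a - 1.
Proof. by move=> fa; apply: cvgB => //; apply: cvg_cst. Qed.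

Lemma cvg_1sub f a : f @ F --> a -> (fun t => 1 - f t) @ F --> 1 - a.
Proof. by move=> fa; apply: cvgB => //; apply: cvg_cst. Qed.

Lemma qcvg_homot0 p xi (f : T -> C) a q x : f @ F --> a -> qnorm x != 0 -> qcvg q x ->
  qcvg (fun t => homot0 p xi (f t) (q t)) (homot0 p xi a x).
Proof.
move=> f1 x0 qx.
have n : (fun t => (qnorm (q t))^-1) @ F --> (qnorm x)^-1 by exact: cvgV (cvg_qnorm qx).
case: qx => [q1 q2].
have f2 := cvg_sub1 f1; have f3 := cvg_sub1 f2.
have f4 := cvg_sub1 f3; have f5 := cvg_sub1 f4.
have {}f1 := cvg_clamp f1; have {}f2 := cvg_clamp f2.
have {}f3 := cvg_clamp f3; have {}f4 := cvg_clamp f4; have {}f5 := cvg_clamp f5.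
have g1 := cvg_1sub f1; have g2 := cvg_1sub f2; have g3 := cvg_1sub f3; have g5 := cvg_1sub f5.
have q2p : (fun t => (q t).2 ^+ p) @ F --> x.2 ^+ p by exact: cvgX.
split; apply: cvgM; [|exact: (cvgD g5 (cvgM f5 n))| |exact: (cvgD g5 (cvgM f5 n))].
  apply: cvgD; apply: cvgM.
  - exact: g2.
  - by apply: cvgX; exact: (cvgD (cvgM g1 q1) (cvgM f1 q2)).
  - exact: f2.
  - apply: cvgD; first exact: (cvgM q1 (cvg_conj q1)).
    exact: (cvgM (cvgM q2 (cvg_conj q2)) q2p).
apply: cvgD; apply: cvgM.
- exact: g3.
- by apply: cvgD (cvgM g1 q2); apply: cvgM q1; apply: cvgM f1 _; exact: cvg_cst.
- exact: f3.
- by apply: cvgM (cvgM q1 q2) _; apply: cvg_sub1; exact: (cvgM f4 q2p).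
Qed.

Lemma qcvg_homot p xi (f : T -> C) a q x : (0 < p)%N -> xi ^+ p = 1 -> xi != 1 ->
  f @ F --> a -> qnorm x != 0 -> qcvg q x ->
  qcvg (fun t => homot p xi (f t) (q t)) (homot p xi a x).
Proof.
move=> p0 xiP xi1 fa x0 qx.
have f5 : (fun t => 5 * f t) @ F --> 5 * a by apply: cvgM => //; apply: cvg_cst.
apply: qcvgM; first exact: qcvg_homot0.
apply: qcvgV; first by rewrite homot0_neq0 ?qone_neq0.
by apply: qcvg_homot0; rewrite ?qone_neq0 //; apply: qcvg_cst.
Qed.

(* Continuous convergence, which spares a topology on the space of paths. *)
Definition pcvg (P : T -> C -> C * C) (g : C -> C * C) :=
  forall (t : T -> C) (t0 : C), t @ F --> t0 -> qcvg (fun i => P i (t i)) (g t0).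

End Convergence.

(** * The null-homotopy on paths from a point to its image under [hmap] *)

Section Contraction.
Variables (C : numClosedFieldType) (p : nat) (xi : C).
Hypothesis p_gt0 : (0 < p)%N.
Hypothesis xiP : xi ^+ p = 1.
Hypothesis xi1 : xi != 1.
Implicit Types (g : C -> C * C) (s t r : C).
Notation amap := (amap p).
Notation hmap := (hmap p).
Notation homot := (homot p xi).
Notation "x ** y" := (qmul x y) (at level 40, left associativity).

(* Paths are parametrised by all of [C]; only their values at 0 and 1 are related. *)
Definition hpath g := (forall t, qnorm (g t) != 0) /\ g 1 = hmap (g 0).

(** A path from 1 to [amap (g 0)]. The homotopy is run backwards from [kmap (g 0)], and the left
    factor moves from the inverse of [kmap (g 0)] to 1, because [g] ends at [hmap (g 0)]. *)
Definition eta g t := g t ** qinv (hmap (g 0)) ** homot (1 - t) (g 0).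

(** The concatenation of [eta] from [r] to 1, [amap \o g], and [hmap \o eta] from 1 back to [r],
    with concatenation replaced by a pointwise product of normalised paths. It runs from [eta g r]
    to [hmap (eta g r)], so it stays a twisted path; at [r = 0] it is a loop at 1. *)
Definition slide g r t :=
  amap (g t) ** qinv (amap (g 0)) ** eta g (r + t * (1 - r)) **
  qinv (hmap (amap (g 0))) ** hmap (eta g (1 - t * (1 - r))).

(** Three stages of unit length in [s]: [slide] moves [r] from 1 to 0 under [amap]; then [homot]
    turns [amap] into [kmap] on the resulting loop; then the loop is traversed only up to a
    parameter shrinking from 1 to 0. The last factor is 1 before the third stage. *)
Definition contract g s t :=
  homot (clamp (s - 1)) (slide g (1 - clamp s) (t * (1 - clamp (s - 1 - 1)))) **
  slide g 0 (1 - clamp (s - 1 - 1)).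

Section Path.
Variable g : C -> C * C.
Hypothesis gP : hpath g.

Let g_neq0 t : qnorm (g t) != 0. Proof. by case: gP. Qed.
Let hg_neq0 t : qnorm (hmap (g t)) != 0. Proof. exact: hmap_neq0. Qed.
Let ag_neq0 t : qnorm (amap (g t)) != 0. Proof. exact: amap_neq0. Qed.
Let hag_neq0 t : qnorm (hmap (amap (g t))) != 0. Proof. exact: hmap_neq0. Qed.

Lemma eta_neq0 t : qnorm (eta g t) != 0.
Proof.
apply: qnormM_neq0; last exact: homot_neq0.
by apply: qnormM_neq0 => //; exact: qnormV_neq0.
Qed.

Lemma eta_0 : eta g 0 = qone C.
Proof.
rewrite /eta subr0 homot_1 // /kmap qmulA qmulKV //.
by rewrite qmulqV.
Qed.

Lemma eta_1 : eta g 1 = amap (g 0).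
Proof. by rewrite /eta subrr homot_0 (proj2 gP) qmulqV // qmul1q. Qed.

Lemma slide_neq0 r t : qnorm (slide g r t) != 0.
Proof.
apply: qnormM_neq0; last exact/hmap_neq0/eta_neq0.
apply: qnormM_neq0; last exact: qnormV_neq0.
apply: qnormM_neq0; last exact: eta_neq0.
by apply: qnormM_neq0 => //; exact: qnormV_neq0.
Qed.

Lemma slide_1 t : slide g 1 t = amap (g t).
Proof. by rewrite /slide subrr mulr0 addr0 subr0 eta_1 qmulKV // qmulKV. Qed.

Lemma slide_t0 r : slide g r 0 = eta g r.
Proof. by rewrite /slide !mul0r addr0 subr0 eta_1 qmulqV // qmul1q qmulKV. Qed.

Lemma slide_t1 r : slide g r 1 = hmap (eta g r).
Proof.
rewrite /slide !mul1r subKr addrC subrK eta_1 qmulKV //.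
by rewrite (proj2 gP) amap_hmap qmulqV // qmul1q.
Qed.

Lemma contract_neq0 s t : qnorm (contract g s t) != 0.
Proof.
by apply: qnormM_neq0; [apply: homot_neq0 => //|]; exact: slide_neq0.
Qed.

Lemma contract_0 t : contract g 0 t = amap (amap (g t)).
Proof.
have R0 : 'Re (0 : C) <= 0 by rewrite raddf0.
have R1 : 'Re (0 - 1 : C) <= 0 by rewrite Re_sub1 subr_le0 (le_trans R0).
have R2 : 'Re (0 - 1 - 1 : C) <= 0 by rewrite Re_sub1 subr_le0 (le_trans R1).
rewrite /contract !clamp_le0 // !subr0 mulr1 slide_1 homot_0.
by rewrite slide_t1 eta_0 hmap1 qmulq1.
Qed.

Lemma contract_ge3 s t : 3 <= 'Re s -> contract g s t = qone C.
Proof.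
move=> s3.
have R2 : 1 <= 'Re (s - 1 - 1).
  rewrite !Re_sub1; have -> : 'Re s - 1 - 1 = ('Re s - 3) + 1 by ring.
  by rewrite lerDr subr_ge0.
have x3 : clamp (s - 1 - 1) = 1 by exact: clamp_ge1.
have x2 : clamp (s - 1) = 1 by apply: clamp_pred_neq0; rewrite x3 oner_eq0.
have x1 : clamp s = 1 by apply: clamp_pred_neq0; rewrite x2 oner_eq0.
rewrite /contract x3 x2 x1 subrr mulr0 slide_t0 eta_0 qmulq1.
by rewrite homot_one.
Qed.

(** In the first stage [amap] commutes with [hmap]; in the second both ends of the loop are 1, which
    [homot] fixes; in the third [kmap l * l = hmap l] at the end and [kmap 1 = 1] at the start. *)
Lemma contract_end s : contract g s 1 = hmap (contract g s 0).
Proof.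
rewrite /contract mul1r mul0r.
have [x3|x3] := eqVneq (clamp (s - 1 - 1)) 0.
  rewrite x3 subr0 !slide_t1 eta_0 hmap1 !qmulq1 slide_t0.
  have [x2|x2] := eqVneq (clamp (s - 1)) 0; first by rewrite x2 !homot_0.
  rewrite (clamp_pred_neq0 x2) subrr eta_0 hmap1 homot_one //.
  by rewrite hmap1.
have x2 := clamp_pred_neq0 x3.
have x1 : clamp s = 1 by apply: clamp_pred_neq0; rewrite x2 oner_eq0.
rewrite x2 x1 subrr slide_t0 eta_0 homot_one // qmul1q homot_1 ?slide_neq0 //.
by rewrite /kmap qmulKV ?slide_neq0.
Qed.

Lemma contract_hpath s : hpath (contract g s).
Proof. by split; [exact: contract_neq0 | exact: contract_end]. Qed.

End Path.

Lemma hpath_one : hpath (fun=> qone C).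
Proof. by split; rewrite ?hmap1 // => t; exact: qone_neq0. Qed.

(** Hence a path that has become constant at 1 stays so under all later steps. *)
Lemma contract_one s t : contract (fun=> qone C) s t = qone C.
Proof.
have E x : eta (fun=> qone C) x = qone C.
  by rewrite /eta hmap1 qinv1 !qmul1q homot_one.
have S r x : slide (fun=> qone C) r x = qone C.
  by rewrite /slide !E amap1 hmap1 qinv1 !qmul1q.
by rewrite /contract !S homot_one // qmul1q.
Qed.

Local Open Scope classical_set_scope.

Lemma pcvg_contract (T : Type) (F : set_system T) (FF : Filter F)
    (P : T -> C -> C * C) g (f : T -> C) s :
  hpath g -> pcvg F P g -> f @ F --> s ->
  pcvg F (fun i => contract (P i) (f i)) (contract g s).
Proof.
move=> gP Pg fs.
have g0 t : qnorm (g t) != 0 by case: gP.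
have cst (z : C) : (fun=> z) @ F --> z by apply: cvg_cst.
have P0 : qcvg F (fun i => P i 0) (g 0) by exact: Pg.
have eta_cvg (t : T -> C) t0 : t @ F --> t0 -> qcvg F (fun i => eta (P i) (t i)) (eta g t0).
  move=> tt0; apply: qcvgM; last by apply: qcvg_homot => //; apply: cvg_1sub.
  apply: qcvgM; first exact: Pg.
  by apply: qcvgV; [exact: hmap_neq0 | exact: qcvg_hmap].
have slide_cvg (r t : T -> C) r0 t0 : r @ F --> r0 -> t @ F --> t0 ->
    qcvg F (fun i => slide (P i) (r i) (t i)) (slide g r0 t0).
  move=> rr0 tt0.
  have tr : (fun i => t i * (1 - r i)) @ F --> t0 * (1 - r0).
    by apply: cvgM => //; apply: cvg_1sub.
  apply: qcvgM; last by apply: qcvg_hmap; apply: eta_cvg; apply: cvg_1sub.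
  apply: qcvgM; last first.
    by apply: qcvgV; [exact/hmap_neq0/amap_neq0 | exact/qcvg_hmap/qcvg_amap].
  apply: qcvgM; last by apply: eta_cvg; apply: cvgD.
  apply: qcvgM; first exact/qcvg_amap/Pg.
  by apply: qcvgV; [exact: amap_neq0 | exact: qcvg_amap].
have f1 : (fun i => f i - 1) @ F --> s - 1 by exact: cvg_sub1.
have f2 : (fun i => 1 - clamp (f i - 1 - 1)) @ F --> 1 - clamp (s - 1 - 1).
  by apply: cvg_1sub; apply: cvg_clamp; apply: cvg_sub1.
move=> t t0 tt0; apply: qcvgM; last exact: slide_cvg.
apply: qcvg_homot => //; first exact: cvg_clamp; first exact: slide_neq0.
by apply: slide_cvg; [apply: cvg_1sub; exact: cvg_clamp | exact: cvgM].
Qed.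

End Contraction.

(** * Equivariant steps *)

Lemma near_cvg (K : numFieldType) (T : Type) (F : set_system T) (FF : Filter F)
    (f g : T -> K) (a : K) :
  F (fun t => f t = g t) -> (g @ F --> a)%classic -> (f @ F --> a)%classic.
Proof.
move=> fg ga; apply/cvgrPdist_lt => e e0; move/cvgrPdist_lt: ga => /(_ e e0).
by apply: filterS2 fg => t ->.
Qed.

(** The index may jump arbitrarily with [t]: finitely many functions with a common limit are close
    to it simultaneously. *)
Lemma select_cvg (K : numFieldType) (T : Type) (F : set_system T) (FF : Filter F)
    (I : finType) (f : T -> K) (g : I -> T -> K) (a : K) :
  (forall t, exists i, f t = g i t) -> (forall i, (g i @ F --> a)%classic) ->
  (f @ F --> a)%classic.
Proof.
move=> fg ga; apply/cvgrPdist_lt => e e0.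
have : F (fun t => forall i, `|a - g i t| < e).
  by apply: filter_forall => i; move/cvgrPdist_lt: (ga i) => /(_ e e0).
by apply: filterS => t; case: (fg t) => i -> /(_ i).
Qed.

Lemma exists_real_max (K : numDomainType) (I : finType) (f : I -> K) (i0 : I) :
  (forall i, f i \is Num.real) -> exists i, forall k, f k <= f i.
Proof.
move=> fr.
have H (s : seq I) : exists i, forall k, k \in i0 :: s -> f k <= f i.
  elim: s => [|j s [i IH]]; first by exists i0 => k; rewrite inE => /eqP->.
  have [fij|fij] := real_leP (fr j) (fr i).
    exists i => k; rewrite !inE => /or3P[/eqP->|/eqP->//|ks]; apply: IH; rewrite inE ?eqxx //.
    by rewrite ks orbT.
  exists j => k; rewrite !inE => /or3P[/eqP->|/eqP->//|ks]; apply: le_trans (ltW fij); apply: IH.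
    by rewrite inE eqxx.
  by rewrite inE ks orbT.
have [i Hi] := H (enum I); exists i => k; apply: Hi.
by rewrite inE mem_enum orbT.
Qed.

(** * Conjugates of the contraction, and the regions where a root of unity can be chosen *)

Section Steps.
Variables (C : numClosedFieldType) (p : nat) (xi : C).
Hypothesis p_gt0 : (0 < p)%N.
Hypothesis xi_prim : p.-primitive_root xi.
Hypothesis xi1 : xi != 1.
Implicit Types (g : C -> C * C) (s t u c w : C) (q : C * C).
Notation amap := (amap p).
Notation hmap := (hmap p).
Notation contract := (contract p xi).
Notation hpath := (hpath p).

Let xiP : xi ^+ p = 1. Proof. exact: prim_expr_order. Qed.

Lemma unity_neq0 c : c ^+ p = 1 -> c != 0.
Proof. by apply: contra_eq_neq => ->; rewrite expr0n gtn_eqF // eq_sym oner_eq0. Qed.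

Let xi0 : xi != 0. Proof. exact: unity_neq0. Qed.

Lemma unityV c : c ^+ p = 1 -> c^-1 ^+ p = 1.
Proof. by move=> cp; rewrite exprVn cp invr1. Qed.

Lemma unity_xi (n : nat) : (xi ^+ n) ^+ p = 1.
Proof. by rewrite exprAC xiP expr1n. Qed.

Definition act u c q : C * C := (u * q.1, c * q.2).

Lemma act_act u c u' c' q : act u c (act u' c' q) = act (u * u') (c * c') q.
Proof. by rewrite /act /= !mulrA. Qed.

Lemma act11 q : act 1 1 q = q.
Proof. by case: q => a b; rewrite /act !mul1r. Qed.

Lemma act_neq0 u c q : u != 0 -> c != 0 -> qnorm q != 0 -> qnorm (act u c q) != 0.
Proof. by move=> u0 c0; rewrite !qnorm_eq0 /= !mulf_eq0 (negPf u0) (negPf c0). Qed.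

Lemma act_one c : act 1 c (qone C) = qone C.
Proof. by rewrite /act /= mulr1 mulr0. Qed.

Lemma amap_act u c q : c ^+ p = 1 -> amap (act u c q) = act (u ^+ p) c (amap q).
Proof. by move=> cp; rewrite /amap /act /= exprMn. Qed.

Lemma hmap_act u c q : c ^+ p = 1 -> hmap (act u c q) = act u c (hmap q).
Proof. by move=> cp; rewrite /hmap /act /= exprMn exprS cp mulr1. Qed.

Lemma act_hpath u c g : u != 0 -> c ^+ p = 1 -> hpath g -> hpath (fun t => act u c (g t)).
Proof.
move=> u0 cp [g0 g1]; split; last by rewrite g1 hmap_act.
by move=> t; apply: act_neq0 => //; exact: unity_neq0.
Qed.

Lemma qcvg_act (T : Type) (F : set_system T) (FF : Filter F) (f : T -> C) u c (P : T -> C * C) q :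
  (f @ F --> u)%classic -> qcvg F P q -> qcvg F (fun i => act (f i) c (P i)) (act u c q).
Proof.
by move=> fu [P1 P2]; split; apply: cvgM => //; apply: cvg_cst.
Qed.

(** The conjugate of [contract] by [xi ^+ j]. It still starts at [amap \o amap], which commutes with
    the action of roots of unity on the second coordinate. *)
Definition branch g (j : 'I_p) s t :=
  act 1 (xi ^+ j) (contract (fun t' => act 1 (xi ^+ j)^-1 (g t')) s t).

(** The entry [S j] is the time at which branch [j] is evaluated. For a [sparse] family the choice
    is forced, and the default is the common value of all branches at time 0. *)
Definition step g (S : 'I_p -> C) t :=
  if [pick j | S j != 0] is Some j then branch g j (S j) t else amap (amap (g t)).

Definition sparse (S : 'I_p -> C) := forall j k, S j != 0 -> S k != 0 -> j = k.

Lemma branch_0 g j t : hpath g -> branch g j 0 t = amap (amap (g t)).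
Proof.
move=> gP; rewrite /branch contract_0 //; last first.
  by apply: act_hpath gP; rewrite ?oner_eq0 // unityV // unity_xi.
rewrite !amap_act ?unityV ?unity_xi // act_act !expr1n mulr1 divff ?act11 //.
by rewrite expf_neq0.
Qed.

Lemma step_some g S j t : sparse S -> S j != 0 -> step g S t = branch g j (S j) t.
Proof.
move=> sS Sj; rewrite /step; case: pickP => [k Sk|/(_ j)]; last by rewrite Sj.
by rewrite (sS _ _ Sk Sj).
Qed.

Lemma step_none g S t : (forall j, S j = 0) -> step g S t = amap (amap (g t)).
Proof. by move=> S0; rewrite /step; case: pickP => // j; rewrite S0 eqxx. Qed.

Lemma step_hpath g S : hpath g -> hpath (step g S).
Proof.
move=> gP; rewrite /step; case: pickP => [j _|_].
  apply: act_hpath; rewrite ?oner_eq0 ?unity_xi //.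
  apply: contract_hpath => //; apply: act_hpath gP; rewrite ?oner_eq0 //.
  by rewrite unityV // unity_xi.
case: gP => g0 g1; split; first by move=> t; do 2 apply: amap_neq0 => //.
by rewrite g1 !amap_hmap.
Qed.

Lemma step_ge3 g S j t : hpath g -> sparse S -> 3 <= 'Re (S j) -> step g S t = qone C.
Proof.
move=> gP sS Sj.
have Sj0 : S j != 0.
  by apply: contraTneq Sj => ->; rewrite raddf0 lt_geF // ltr0n.
rewrite (step_some _ _ sS Sj0) /branch contract_ge3 ?act_one //.
by apply: act_hpath gP; rewrite ?oner_eq0 // unityV // unity_xi.
Qed.

Lemma step_one S t : step (fun=> qone C) S t = qone C.
Proof.
rewrite /step; case: pickP => [j _|_]; last by rewrite !amap1.
have -> : branch (fun=> qone C) j (S j) t = act 1 (xi ^+ j) (contract (fun=> qone C) (S j) t).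
  by rewrite /branch; under eq_fun do rewrite act_one.
by rewrite contract_one // act_one.
Qed.

(** Multiplication by [c] permutes the roots [xi ^+ j], hence the conjugates of [contract]; the
    times have to be permuted in the same way. *)
Lemma step_act c g S S' t : c ^+ p = 1 -> sparse S' ->
  (forall j k : 'I_p, xi ^+ k = c * xi ^+ j -> S' k = S j) ->
  step (fun t' => act 1 c (g t')) S' t = act 1 c (step g S t).
Proof.
move=> cp sS' SS'.
have c0 := unity_neq0 cp.
have [[j Sj]|S0] := pselect (exists j, S j != 0).
  have [k kE] : {k : 'I_p | c * xi ^+ j = xi ^+ k}.
    by apply: prim_rootP => //; rewrite exprMn cp unity_xi mulr1.
  have S'k : S' k = S j by exact/SS'/esym.
  have sS : sparse S.
    move=> a b Sa Sb; apply: ord_inj; apply/eqP.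
    have [a' aE] : {k : 'I_p | c * xi ^+ a = xi ^+ k}.
      by apply: prim_rootP => //; rewrite exprMn cp unity_xi mulr1.
    have [b' bE] : {k : 'I_p | c * xi ^+ b = xi ^+ k}.
      by apply: prim_rootP => //; rewrite exprMn cp unity_xi mulr1.
    have e : a' = b' by apply: sS'; rewrite (SS' _ _ (esym aE), SS' _ _ (esym bE)).
    have /eqP : xi ^+ a = xi ^+ b by apply: (mulfI c0); rewrite aE bE e.
    by rewrite (eq_prim_root_expr xi_prim) /eqn !modn_small.
  rewrite (step_some _ _ sS Sj) (@step_some _ _ k) ?S'k // /branch act_act -kE mulr1.
  have -> : (fun t' => act 1 (c * xi ^+ j)^-1 (act 1 c (g t'))) =
            (fun t' => act 1 (xi ^+ j)^-1 (g t')); last by [].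
  by apply/funext => t'; rewrite act_act mulr1 invfM mulrAC mulVf // mul1r.
have {}S0 j : S j = 0.
  by apply/eqP/negPn/negP => Sj; apply: S0; exists j.
rewrite !step_none // => [|k]; first by rewrite !amap_act // !expr1n.
have [j jE] : {j : 'I_p | c^-1 * xi ^+ k = xi ^+ j}.
  by apply: prim_rootP => //; rewrite exprMn unityV // unity_xi mulr1.
by rewrite (SS' j k) // -jE mulrA divff // mul1r.
Qed.

Lemma pcvg_branch (T : Type) (F : set_system T) (FF : Filter F)
    (P : T -> C -> C * C) g j (f : T -> C) s :
  hpath g -> pcvg F P g -> (f @ F --> s)%classic ->
  pcvg F (fun i => branch (P i) j (f i)) (branch g j s).
Proof.
move=> gP Pg fs t t0 tt0; apply: qcvg_act; first exact: cvg_cst.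
apply: (@pcvg_contract _ _ _ _ _ _ _ _ _ (fun i t' => act 1 (xi ^+ j)^-1 (P i t'))) => //.
  by apply: act_hpath gP; rewrite ?oner_eq0 // unityV // unity_xi.
by move=> t' t0' tt'; apply: qcvg_act; [exact: cvg_cst | exact: Pg].
Qed.

(** If some [S0 j] is nonzero, branch [j] is the one selected nearby. If all vanish, every candidate
    tends to the same limit by [branch_0], and [select_cvg] applies. *)
Lemma pcvg_step (T : Type) (F : set_system T) (FF : Filter F)
    (P : T -> C -> C * C) g (S : T -> 'I_p -> C) (S0 : 'I_p -> C) :
  hpath g -> pcvg F P g -> (forall j, ((fun i => S i j) @ F --> S0 j)%classic) ->
  (forall i, sparse (S i)) -> sparse S0 ->
  pcvg F (fun i => step (P i) (S i)) (step g S0).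
Proof.
move=> gP Pg SS0 sS sS0 t t0 tt0.
have [[j Sj]|S00] := pselect (exists j, S0 j != 0).
  have nS : F (fun i => step (P i) (S i) (t i) = branch (P i) j (S i j) (t i)).
    move/cvgrPdist_lt: (SS0 j) => /(_ `|S0 j|); rewrite normr_gt0 => /(_ Sj).
    apply: filterS => i Si; apply: step_some => //.
    by apply: contraTneq Si => ->; rewrite subr0 ltxx.
  rewrite (step_some _ _ sS0 Sj).
  have [b1 b2] : qcvg F (fun i => branch (P i) j (S i j) (t i)) (branch g j (S0 j) t0).
    exact: (@pcvg_branch _ _ _ P g j (fun i => S i j)).
  by split; [apply: near_cvg b1 | apply: near_cvg b2]; apply: filterS nS => i ->.
have {}S00 j : S0 j = 0.
  by apply/eqP/negPn/negP => Sj; apply: S00; exists j.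
rewrite step_none //.
pose G (o : option 'I_p) i := if o is Some j then branch (P i) j (S i j) (t i)
  else amap (amap (P i (t i))).
have GE i : exists o, step (P i) (S i) (t i) = G o i.
  by rewrite /step; case: pickP => [j _|_]; [exists (Some j) | exists None].
have GC o : qcvg F (G o) (amap (amap (g t0))).
  case: o => [j|]; last by do 2 apply: qcvg_amap; exact: Pg.
  rewrite -(branch_0 j t0 gP) -(S00 j).
  exact: pcvg_branch.
split; [apply: (@select_cvg _ _ _ _ _ _ (fun o i => (G o i).1)) |
        apply: (@select_cvg _ _ _ _ _ _ (fun o i => (G o i).2))].
- by move=> i; have [o ->] := GE i; exists o.
- by move=> o; have [] := GC o.
- by move=> i; have [o ->] := GE i; exists o.
- by move=> o; have [] := GC o.
Qed.

Fixpoint steps g (S : nat -> 'I_p -> C) (L : nat) : C -> C * C :=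
  if L is l.+1 then step (steps g S l) (S l) else g.

Lemma steps_hpath g S L : hpath g -> hpath (steps g S L).
Proof. by move=> gP; elim: L => //= l IH; exact: step_hpath. Qed.

Lemma steps_none g S L t : (forall l j, S l j = 0) ->
  steps g S L t = iter L (amap \o amap) (g t).
Proof.
move=> S0; elim: L t => //= l IH t.
by rewrite step_none // IH.
Qed.

(** One step run to time 3 makes the path constant at 1, and [step_one] preserves this at all later
    levels. *)
Lemma steps_ge3 g S L l j t : hpath g -> (forall l, sparse (S l)) -> (l < L)%N ->
  3 <= 'Re (S l j) -> steps g S L t = qone C.
Proof.
move=> gP sS lL Slj; elim: L lL t => // L IH; rewrite ltnS leq_eqVlt => /orP[/eqP <-|lL] t /=.
  by apply: (@step_ge3 _ _ j) => //; exact: steps_hpath.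
rewrite (_ : steps g S L = fun=> qone C) ?step_one //.
by apply/funext => t'; exact: IH.
Qed.

Lemma steps_act c g S S' L t : c ^+ p = 1 -> (forall l, sparse (S' l)) ->
  (forall l (j k : 'I_p), xi ^+ k = c * xi ^+ j -> S' l k = S l j) ->
  steps (fun t' => act 1 c (g t')) S' L t = act 1 c (steps g S L t).
Proof.
move=> cp sS' SS'; elim: L t => //= L IH t.
rewrite (_ : steps _ S' L = fun t' => act 1 c (steps g S L t')); last exact/funext.
by apply: step_act => //; exact: SS'.
Qed.

Lemma pcvg_steps (T : Type) (F : set_system T) (FF : Filter F)
    (P : T -> C -> C * C) g (S : T -> nat -> 'I_p -> C) (S0 : nat -> 'I_p -> C) L :
  hpath g -> pcvg F P g -> (forall l j, ((fun i => S i l j) @ F --> S0 l j)%classic) ->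
  (forall i l, sparse (S i l)) -> (forall l, sparse (S0 l)) ->
  pcvg F (fun i => steps (P i) (S i) L) (steps g S0 L).
Proof.
move=> gP Pg SS0 sS sS0; elim: L => //= L IH.
by apply: (@pcvg_step _ _ _ _ _ (fun i => S i L)) => //; exact: steps_hpath.
Qed.

(* Positive exactly when [w] has the strictly largest real part in its orbit
   under the [p]-th roots of unity. *)
Definition gap w := \prod_(1 <= i < p) pospart (w - xi ^+ i * w).

Lemma gap_ge0 w : 0 <= gap w.
Proof. by apply: prodr_ge0 => i _; exact: pospart_ge0. Qed.

Lemma gap_lt w i : gap w != 0 -> (0 < i < p)%N -> 'Re (xi ^+ i * w) < 'Re w.
Proof.
rewrite prodf_seq_neq0 => /allP/(_ i); rewrite mem_index_iota => h ip.
by move: (h ip); rewrite pospart_neq0 raddfB subr_gt0.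
Qed.

(** Two different rotations of [w] cannot both have a real part strictly larger than all the
    others. *)
Lemma gap_sparse w s : sparse (fun j => s * gap (w / xi ^+ j)).
Proof.
have main (j k : 'I_p) : j != k -> gap (w / xi ^+ j) != 0 ->
    'Re (w / xi ^+ k) < 'Re (w / xi ^+ j).
  move=> jk gj.
  have [i iE] : {i : 'I_p | xi ^+ j / xi ^+ k = xi ^+ i}.
    by apply: prim_rootP => //; rewrite exprMn unityV // ?unity_xi // mulr1.
  have -> : w / xi ^+ k = xi ^+ i * (w / xi ^+ j).
    by rewrite -iE; field; rewrite !expf_neq0.
  apply: gap_lt => //; rewrite ltn_ord andbT lt0n.
  apply: contra_neq jk => i0; apply/ord_inj/eqP.
  have /eqP : xi ^+ j = xi ^+ k.
    by apply: (mulIf (invr_neq0 (expf_neq0 k xi0))); rewrite iE i0 expr0 divff // expf_neq0.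
  by rewrite (eq_prim_root_expr xi_prim) /eqn !modn_small.
move=> j k; rewrite !mulf_eq0 !negb_or => /andP[_ gj] /andP[_ gk].
apply/eqP/negPn/negP => jk.
have := main _ _ jk gj; rewrite eq_sym in jk; have := main _ _ jk gk.
by move=> /lt_trans h /h; rewrite ltxx.
Qed.

(** Choose the rotation [u] of [w] with largest real part. If its gap vanishes, another rotation [v]
    has the same real part and the same modulus, so [v] is [u] or its conjugate; the latter makes
    [w ^+ p] real. *)
Lemma gap_exists w : (w ^+ p \isn't Num.real) -> exists j : 'I_p, gap (w / xi ^+ j) != 0.
Proof.
move=> wp; have w0 : w != 0 by apply: contraNneq wp => ->; rewrite expr0n gtn_eqF.
have [j jmax] := @exists_real_max _ _ (fun j : 'I_p => 'Re (w / xi ^+ j)) (Ordinal p_gt0)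
  (fun j => Creal_Re _).
exists j; apply: contra wp; rewrite prodf_seq_eq0 => /hasP[] i.
rewrite mem_index_iota => /andP[i0 ip].
set u := w / xi ^+ j; set v := xi ^+ i * u => /eqP uv.
have u0 : u != 0 by rewrite mulf_neq0 // invr_neq0 // expf_neq0.
have vE : v ^+ p = w ^+ p by rewrite !exprMn unity_xi mul1r unityV ?unity_xi // mulr1.
have uE : u ^+ p = w ^+ p by rewrite exprMn unityV ?unity_xi // mulr1.
have Re_uv : 'Re v = 'Re u.
  apply/le_anti/andP; split.
    have [k kE] : {k : 'I_p | xi ^+ j / xi ^+ i = xi ^+ k}.
      by apply: prim_rootP => //; rewrite exprMn unityV // ?unity_xi // mulr1.
    have -> : v = w / xi ^+ k by rewrite -kE /v /u; field; rewrite !expf_neq0.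
    exact: jmax.
  rewrite -subr_le0 -raddfB.
  have [h|//] := real_ltP (real0 C) (Creal_Re (u - v)).
  by move: h; rewrite -pospart_neq0 uv eqxx.
have norm1 : `|xi ^+ i| = 1.
  by apply/eqP; rewrite -(@pexpr_eq1 _ _ p) // -normrX unity_xi normr1.
have uv_norm : v * v^* = u * u^* by rewrite -!normCK normrM norm1 mul1r.
have uv_sum : v + v^* = u + u^*.
  by move: Re_uv; rewrite !ReE => /(mulIf (invr_neq0 _)); apply; rewrite pnatr_eq0.
(* Equal sums and equal products with their conjugates make [u] and [v] roots of one real quadratic.
   The root [v = u] is excluded by primitivity of [xi]. *)
have : (v - u) * (v - u^*) == 0.
  have -> : (v - u) * (v - u^*) = v * (v + v^*) - v * v^* + u * u^* - v * (u + u^*) by ring.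
  by rewrite uv_sum uv_norm; apply/eqP; ring.
rewrite mulf_eq0 !subr_eq0 => /orP[|/eqP vu].
  rewrite /v -[X in _ == X]mul1r => /eqP/(mulIf u0)/eqP.
  by rewrite -(prim_order_dvd xi_prim) gtnNdvd.
by apply/CrealP; rewrite -[in LHS]vE vu rmorphXn /= conjCK uE.
Qed.

Lemma gap_sum_rot c w : c ^+ p = 1 ->
  \sum_(j < p) gap (c * w / xi ^+ j) = \sum_(j < p) gap (w / xi ^+ j).
Proof.
move=> cp; have [l lE] : {l : 'I_p | c = xi ^+ l} by exact: prim_rootP.
pose h (j : 'I_p) := Ordinal (ltn_pmod (j + l) p_gt0).
have h_inj : injective h.
  move=> j k [] /eqP; rewrite eqn_modDr !modn_small // => /eqP; exact: ord_inj.
rewrite (reindex_inj h_inj); apply: eq_bigr => j _ /=.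
by rewrite (prim_expr_mod xi_prim) exprD lE; congr gap; field; rewrite !expf_neq0.
Qed.

End Steps.

(** * The induction on n *)

Lemma near_gt0 (K : numFieldType) (T : Type) (F : set_system T) (FF : Filter F)
    (f : T -> K) (a : K) :
  (forall t, f t \is Num.real) -> (f @ F --> a)%classic -> 0 < a -> F (fun t => 0 < f t).
Proof.
move=> fr fa a0; move/cvgrPdist_lt: fa => /(_ a a0); apply: filterS => t.
have afr : a - f t \is Num.real by rewrite rpredB // gtr0_real.
by move/(le_lt_trans (real_ler_norm afr)); rewrite ltrBlDr ltrDl.
Qed.

Section Induction.
Variables (C : numClosedFieldType) (p : nat) (xi zeta : C).
Hypothesis p_gt0 : (0 < p)%N.
Hypothesis xi_prim : p.-primitive_root xi.
Hypothesis xi1 : xi != 1.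
Hypothesis zetaP : zeta ^+ p = 'i.
Implicit Types (v y : nat -> C) (x t u c w : C) (q : C * C).
Notation amap := (amap p).
Notation hmap := (hmap p).
Notation hpath := (hpath p).
Notation gap := (gap p xi).
Notation steps := (steps xi).

Let xiP : xi ^+ p = 1. Proof. exact: prim_expr_order. Qed.

Definition sqnorm n y : C := \sum_(k < n) `|y k| ^+ 2.

Lemma sqnorm_ge0 n y : 0 <= sqnorm n y.
Proof. by apply: sumr_ge0 => k _; exact: exprn_ge0. Qed.

Lemma sqnormS n v : sqnorm n.+1 v = `|v 0%N| ^+ 2 + sqnorm n (fun k => v k.+1).
Proof. by rewrite /sqnorm big_ord_recl. Qed.

(* Vectors of [V_n] are functions on [nat] of which only the first [n] values matter. *)
Definition vact u c v : nat -> C := fun k => u ^+ (p ^ k) * c * v k.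

Lemma sqnorm_rot n u c v : `|u| = 1 -> `|c| = 1 -> sqnorm n (vact u c v) = sqnorm n v.
Proof.
by move=> u1 c1; apply: eq_bigr => k _; rewrite /vact !normrM normrX u1 c1 expr1n !mul1r.
Qed.

(* Since [zeta ^+ p = 'i], the [p]-th powers of [y k] and [zeta * y k] are both real
   only for [y k = 0], so that [gap_exists] applies to one of them otherwise. *)
Definition wcoord y l := (if odd l then zeta else 1) * y l./2.

Definition gapsum n y := \sum_(l < n.*2) \sum_(j < p) gap (wcoord y l / xi ^+ j).

Lemma gapsum_ge0 n y : 0 <= gapsum n y.
Proof. by apply: sumr_ge0 => l _; apply: sumr_ge0 => j _; exact: gap_ge0. Qed.

Lemma gapsum_neq0 n y : sqnorm n y != 0 -> gapsum n y != 0.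
Proof.
apply: contra_neq => g0.
have gap0 (l : nat) (j : 'I_p) : (l < n.*2)%N -> gap (wcoord y l / xi ^+ j) = 0.
  move=> ln; have gs (i : nat) : 0 <= \sum_(j < p) gap (wcoord y i / xi ^+ j).
    by apply: sumr_ge0 => *; exact: gap_ge0.
  move/eqP: g0; rewrite psumr_eq0; last by move=> *; exact: gs.
  move/allP/(_ (Ordinal ln)); rewrite mem_index_enum => /(_ isT) /=.
  rewrite psumr_eq0; last by move=> *; exact: gap_ge0.
  by move/allP/(_ j); rewrite mem_index_enum => /(_ isT) /= /eqP.
have wreal l : (l < n.*2)%N -> wcoord y l ^+ p \is Num.real.
  move=> ln; apply/negPn/negP => /(gap_exists p_gt0 xi_prim)[j].
  by rewrite gap0 // eqxx.
apply: big1 => k _; apply/eqP; rewrite expf_eq0 /= normr_eq0.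
have kn : (k.*2.+1 < n.*2)%N by rewrite -doubleS leq_double.
have := wreal k.*2 (ltnW kn); have := wreal k.*2.+1 kn.
rewrite /wcoord /= odd_double /= uphalf_double doubleK mul1r exprMn zetaP.
move=> /CrealP h1 /CrealP h2.
suff : y k ^+ p == 0 by rewrite expf_eq0 p_gt0.
move/eqP: h1; rewrite rmorphM /= conjCi h2 mulNr eq_sym -addr_eq0 -mulr2n mulrn_eq0 /=.
by rewrite mulf_eq0 (negPf (neq0Ci C)).
Qed.

Definition dir x : C := x / `|x|.

Lemma norm_dir x : x != 0 -> `|dir x| = 1.
Proof. by move=> x0; rewrite normrM normfV normr_id divff // normr_eq0. Qed.

Lemma dir_neq0 x : x != 0 -> dir x != 0.
Proof. by move=> x0; rewrite -normr_eq0 norm_dir // oner_eq0. Qed.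

(* Coordinates [1, 2, ...] after the gauge rotation making the 0th one positive. *)
Definition turn v := vact ((dir (v 0%N))^-1 ^+ p) 1 (fun k => v k.+1).

Lemma sqnorm_turn n v : v 0%N != 0 -> sqnorm n (turn v) = sqnorm n (fun k => v k.+1).
Proof.
by move=> v0; rewrite sqnorm_rot ?normr1 // normrX normfV norm_dir // invr1 expr1n.
Qed.

(** The times of step [l]. They vanish for [2 * |x|^2 <= |y|^2], where [x] is coordinate 0 and [y]
    the rest. Some gap is at least the average [gapsum / (2 n p)], so the factor [3 * (n.*2 * p)]
    brings some time up to 3 once [0 < |y|^2 <= |x|^2]. *)
Definition weight n v l (j : 'I_p) :=
  3 * (n.*2 * p)%:R * pospart (2 * `|v 0%N| ^+ 2 - sqnorm n (fun k => v k.+1)) /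
    (sqnorm n (fun k => v k.+1) * gapsum n (turn v)) *
  gap (wcoord (turn v) l / xi ^+ j).

Lemma weight_sparse n v l : sparse (weight n v l).
Proof. exact: gap_sparse. Qed.

Lemma weight_0 n v l j :
  2 * `|v 0%N| ^+ 2 <= sqnorm n (fun k => v k.+1) -> weight n v l j = 0.
Proof.
move=> h; rewrite /weight pospart_le0 ?mulr0 ?mul0r //.
rewrite (Creal_ReP _ _) ?subr_le0 // rpredB // ?ger0_real ?sqnorm_ge0 //.
by rewrite mulr_ge0 // exprn_ge0.
Qed.

Lemma weight_ge3 n v : v 0%N != 0 -> sqnorm n (fun k => v k.+1) != 0 ->
  sqnorm n (fun k => v k.+1) <= `|v 0%N| ^+ 2 ->
  exists l j, (l < n.*2)%N /\ 3 <= 'Re (weight n v l j).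
Proof.
set s := sqnorm _ _ => v0 s0 sv.
have g0 : gapsum n (turn v) != 0 by rewrite gapsum_neq0 // sqnorm_turn.
have s_gt0 : 0 < s by rewrite lt0r s0 sqnorm_ge0.
have g_gt0 : 0 < gapsum n (turn v) by rewrite lt0r g0 gapsum_ge0.
have n0 : (0 < n.*2)%N.
  by rewrite double_gt0 lt0n; apply: contra_neq s0 => n0; rewrite /s /sqnorm n0 big_ord0.
have [[l j] /= lj] := @exists_real_max _ _
  (fun a : 'I_n.*2 * 'I_p => gap (wcoord (turn v) a.1 / xi ^+ a.2))
  (Ordinal n0, Ordinal p_gt0) (fun a => ger0_real (gap_ge0 _ _ _)).
exists l, j; split => //.
have gK : gapsum n (turn v) <= (n.*2 * p)%:R * gap (wcoord (turn v) l / xi ^+ j).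
  rewrite /gapsum pair_bigA /=.
  apply: le_trans (ler_sum _ (fun a _ => lj a)) _.
  by rewrite sumr_const card_prod !card_ord mulr_natl.
have P : pospart (2 * `|v 0%N| ^+ 2 - s) = 2 * `|v 0%N| ^+ 2 - s.
  have r : 2 * `|v 0%N| ^+ 2 - s \is Num.real.
    by rewrite rpredB // ?ger0_real ?mulr_ge0 ?exprn_ge0 // ltW.
  rewrite pospart_ge (Creal_ReP _ r) // subr_ge0 (le_trans sv) //.
  by rewrite ler_peMl ?exprn_ge0 // ler1n.
have sP : s <= pospart (2 * `|v 0%N| ^+ 2 - s).
  rewrite P lerBrDr; have -> : s + s = 2 * s by ring.
  by rewrite ler_pM2l // ltr0n.
have -> : 'Re (weight n v l j) = weight n v l j.
  apply/Creal_ReP/ger0_real; rewrite /weight -/s.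
  apply: mulr_ge0; last exact: gap_ge0.
  apply: mulr_ge0; last by rewrite invr_ge0 mulr_ge0 // ltW.
  by apply: mulr_ge0; [rewrite mulr_ge0 | exact: pospart_ge0].
rewrite /weight -/s.
have -> : 3 * (n.*2 * p)%:R * pospart (2 * `|v 0%N| ^+ 2 - s) / (s * gapsum n (turn v)) *
   gap (wcoord (turn v) l / xi ^+ j) =
   3 * (pospart (2 * `|v 0%N| ^+ 2 - s) / s *
        ((n.*2 * p)%:R * gap (wcoord (turn v) l / xi ^+ j) / gapsum n (turn v))).
  by field; rewrite s0 g0.
rewrite ler_pMr ?ltr0n //; apply: mulr_ege1; first by rewrite ler_pdivlMr // mul1r.
by rewrite ler_pdivlMr // mul1r.
Qed.

Definition aiter L q := iter L (amap \o amap) q.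

Lemma aiter_act L u c q : c ^+ p = 1 ->
  aiter L (act u c q) = act (u ^+ (p ^ (2 * L))) c (aiter L q).
Proof.
move=> cp; elim: L => [|L IH]; first by rewrite muln0 expn0 expr1.
by rewrite /aiter !iterS -!/(aiter _ _) IH /= !amap_act // -!exprM mulnS addnC expnD expnS expn1 mulnA.
Qed.

Lemma aiter_hpath L g : hpath g -> hpath (fun t => aiter L (g t)).
Proof.
move=> gP; elim: L => [//|L [IH0 IH1]]; split => [t|].
  by rewrite /aiter iterS; do 2 apply: amap_neq0 => //; exact: IH0.
by rewrite /aiter !iterS -!/(aiter _ _) IH1 /= !amap_hmap.
Qed.

Lemma qcvg_aiter (T : Type) (F : set_system T) (FF : Filter F) L (P : T -> C * C) q :
  qcvg F P q -> qcvg F (fun i => aiter L (P i)) (aiter L q).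
Proof.
by move=> Pq; elim: L => [//|L IH]; do 2 apply: qcvg_amap.
Qed.

(** Maps are taken on nonzero vectors and nonzero quaternions, so that normalisation is postponed to
    the end. *)
Record good n m (f : (nat -> C) -> C -> C * C) : Prop := Good {
  good_rot : forall u c v t, `|u| = 1 -> c ^+ p = 1 -> sqnorm n v != 0 ->
    f (vact u c v) t = act (u ^+ (p ^ m)) c (f v t);
  good_hpath : forall v, sqnorm n v != 0 -> hpath (f v);
  good_cvg : forall (T : Type) (F : set_system T) (FF : Filter F)
      (z : T -> nat -> C) v, (forall k, ((fun i => z i k) @ F --> v k)%classic) ->
    sqnorm n v != 0 -> pcvg F (fun i => f (z i)) (f v) }.

(** At [x = 0] the direction of [x] degenerates, and at [y = 0] the quotient in [weight] does; both
    values are the ones that the last formula takes nearby. *)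
Definition next_fun n m f v t : C * C :=
  if v 0%N == 0 then aiter n.*2 (f (fun k => v k.+1) t)
  else act (dir (v 0%N) ^+ (p ^ m)) 1
    (if sqnorm n (fun k => v k.+1) == 0 then qone C
     else steps (f (turn v)) (weight n v) n.*2 t).

(** * The induction step: equivariance and continuity of the extension *)

Section Next.
Variables (n m : nat) (f : (nat -> C) -> C -> C * C).
Hypothesis fP : good n m f.
(** Pulling [V_n] back under the [p]-th power costs one exponent, and each of the [n.*2] steps
    contains two factors [amap]. *)
Let m' := (m.+1 + 2 * n.*2)%N.
Let g := next_fun n m' f.

Let norm_unity c : c ^+ p = 1 -> `|c| = 1.
Proof. by move=> cp; apply/eqP; rewrite -(@pexpr_eq1 _ _ p) // -normrX cp normr1. Qed.

Lemma next_hpath v : sqnorm n.+1 v != 0 -> hpath (g v).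
Proof.
rewrite sqnormS /g /next_fun; have [->|v0] := eqVneq (v 0%N) 0.
  rewrite normr0 expr0n add0r => y0; apply: aiter_hpath.
  exact: (good_hpath fP y0).
move=> _; apply: act_hpath; rewrite ?expr1n ?expf_neq0 ?dir_neq0 //.
have [_|y0] := eqVneq (sqnorm n _) 0; first exact: hpath_one.
by apply: steps_hpath => //; apply: (good_hpath fP); rewrite sqnorm_turn.
Qed.

Lemma next_rot u c v t : `|u| = 1 -> c ^+ p = 1 -> sqnorm n.+1 v != 0 ->
  g (vact u c v) t = act (u ^+ (p ^ m')) c (g v t).
Proof.
move=> u1 cp; rewrite sqnormS; have c1 := norm_unity cp.
have u0 : u != 0 by rewrite -normr_eq0 u1 oner_eq0.
have c0 : c != 0 by rewrite -normr_eq0 c1 oner_eq0.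
have yE : (fun k => vact u c v k.+1) = vact (u ^+ p) c (fun k => v k.+1).
  by apply/funext => k; rewrite /vact -exprM -expnS.
have sE : sqnorm n (fun k => vact u c v k.+1) = sqnorm n (fun k => v k.+1).
  by rewrite yE sqnorm_rot // normrX u1 expr1n.
have xE : vact u c v 0%N = u * c * v 0%N by rewrite /vact expn0 expr1.
have x0E : (vact u c v 0%N == 0) = (v 0%N == 0).
  by rewrite xE !mulf_eq0 (negPf u0) (negPf c0).
rewrite /g /next_fun x0E; have [v0|v0 _] := eqVneq (v 0%N) 0.
  rewrite v0 normr0 expr0n add0r => y0.
  rewrite yE (good_rot fP) // ?normrX ?u1 ?expr1n // aiter_act //.
  by rewrite -!exprM /m' addSn expnS expnD ?mulnA.
have nxE : `|vact u c v 0%N| = `|v 0%N| by rewrite xE !normrM u1 c1 !mul1r.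
have dE : dir (vact u c v 0%N) = u * c * dir (v 0%N) by rewrite /dir nxE xE mulrA.
(* The gauge absorbs [u], while [c] enters it only through powers divisible by [p], which are 1.
   Only the scalar action of [c] remains. *)
have tE : turn (vact u c v) = vact 1 c (turn v).
  apply/funext => k; rewrite /turn dE /vact /= expr1n mulr1 mul1r !invfM !exprMn -!exprM -expnS.
  have -> : c^-1 ^+ (p ^ k.+1) = 1 by rewrite expnS exprM unityV // expr1n.
  have up : u^-1 ^+ (p ^ k.+1) * u ^+ (p ^ k.+1) = 1.
    by rewrite -exprMn mulVf // expr1n.
  by rewrite -[RHS]mulr1 -up; ring.
have dpE : dir (vact u c v 0%N) ^+ (p ^ m') = u ^+ (p ^ m') * dir (v 0%N) ^+ (p ^ m').
  by rewrite dE !exprMn /m' addSn expnS [c ^+ _]exprM cp expr1n mulr1.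
rewrite dpE sE; have [s0|s0] := eqVneq (sqnorm n _) 0.
  by rewrite act_act mulr1 /act /= !mulr1 !mulr0.
have -> : f (turn (vact u c v)) = fun t' => act 1 c (f (turn v) t').
  by apply/funext => t'; rewrite tE (good_rot fP) ?normr1 ?expr1n // sqnorm_turn.
suff -> : steps (fun t' => act 1 c (f (turn v) t')) (weight n (vact u c v)) n.*2 t =
          act 1 c (steps (f (turn v)) (weight n v) n.*2 t).
  by rewrite !act_act !mulr1 mul1r.
apply: steps_act => //; first by move=> l; exact: weight_sparse.
move=> l j k jk; have wE i : wcoord (turn (vact u c v)) i = c * wcoord (turn v) i.
  by rewrite tE /wcoord /vact expr1n mul1r; ring.
rewrite /weight sE nxE wE jk.
have -> : gapsum n (turn (vact u c v)) = gapsum n (turn v).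
  by apply: eq_bigr => i _; rewrite wE gap_sum_rot.
congr (_ * gap _); field; rewrite c0 expf_neq0 //.
exact: unity_neq0 xiP.
Qed.

Lemma cvg_sqnorm (T : Type) (F : set_system T) (FF : Filter F) (z : T -> nat -> C) v k :
  (forall j, ((fun i => z i j) @ F --> v j)%classic) ->
  ((fun i => sqnorm k (z i)) @ F --> sqnorm k v)%classic.
Proof.
move=> zv; apply: cvg_big => [|j _]; first exact: add_continuous.
by apply: cvgX; apply: cvg_norm; exact: zv.
Qed.

(** There are three cases for the limit point. Near [x = 0] all weights vanish; near [y = 0] either
    [y] is still 0 or some weight is at least 3; elsewhere every ingredient of the formula is
    continuous. *)
Lemma next_cvg (T : Type) (F : set_system T) (FF : Filter F) (z : T -> nat -> C) v :
  (forall k, ((fun i => z i k) @ F --> v k)%classic) ->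
  sqnorm n.+1 v != 0 -> pcvg F (fun i => g (z i)) (g v).
Proof.
move=> zv; rewrite sqnormS => v_neq0 t t0 tt0.
have x_cvg := zv 0%N.
have y_cvg k : ((fun i => z i k.+1) @ F --> v k.+1)%classic by exact: zv.
have s_cvg : ((fun i => sqnorm n (fun k => z i k.+1)) @ F --> sqnorm n (fun k => v k.+1))%classic.
  exact: (@cvg_sqnorm T F FF (fun i k => z i k.+1)).
have n_cvg : ((fun i => `|z i 0%N| ^+ 2) @ F --> `|v 0%N| ^+ 2)%classic.
  by apply: cvgX; apply: cvg_norm.
have near_eq (h : T -> C * C) q : F (fun i => g (z i) (t i) = h i) -> qcvg F h q ->
    qcvg F (fun i => g (z i) (t i)) q.
  move=> gh [h1 h2].
  by split; [apply: near_cvg h1 | apply: near_cvg h2]; apply: filterS gh => i ->.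
have [v0|v0] := eqVneq (v 0%N) 0.
  move: v_neq0; rewrite v0 normr0 expr0n add0r => s0.
  rewrite /g /next_fun v0 eqxx; apply: (near_eq (fun i => aiter n.*2 (f (fun k => z i k.+1) (t i)))); last first.
    by apply: qcvg_aiter; apply: (@good_cvg _ _ _ fP T F FF (fun i k => z i k.+1)).
  have : F (fun i => 0 < sqnorm n (fun k => z i k.+1) - 2 * `|z i 0%N| ^+ 2).
    apply: (@near_gt0 _ _ _ FF _ (sqnorm n (fun k => v k.+1) - 2 * `|v 0%N| ^+ 2)).
    - by move=> i; rewrite rpredB // ger0_real ?sqnorm_ge0 // mulr_ge0 // exprn_ge0.
    - by apply: cvgB => //; apply: cvgM => //; apply: cvg_cst.
    - by rewrite v0 normr0 expr0n mulr0 subr0 lt0r s0 sqnorm_ge0.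
  apply: filterS => i; rewrite subr_gt0 => lt_i.
  have [x0|x0] := eqVneq (z i 0%N) 0; first by rewrite /g /next_fun x0 eqxx.
  have si0 : sqnorm n (fun k => z i k.+1) != 0.
    by rewrite gt_eqF // (le_lt_trans _ lt_i) // mulr_ge0 // exprn_ge0.
  rewrite /g /next_fun (negPf x0) (negPf si0) steps_none; last first.
    by move=> l j; apply: weight_0; exact: ltW.
  (* With all weights zero only [aiter] is left; its equivariance undoes the gauge rotation and
     cancels the direction factor. *)
  have yE : (fun k => z i k.+1) = vact (dir (z i 0%N) ^+ p) 1 (turn (z i)).
    apply/funext => k; rewrite /turn /vact !mulr1 mulrA -exprMn -exprMn divff ?expr1n ?mul1r //.
    exact: dir_neq0.
  rewrite [in RHS]yE (good_rot fP) ?sqnorm_turn ?expr1n // ?normrX ?norm_dir ?expr1n //.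
  by rewrite aiter_act ?expr1n // -!exprM /m' addSn expnS expnD ?mulnA.
have d_cvg : ((fun i => dir (z i 0%N)) @ F --> dir (v 0%N))%classic.
  apply: cvgM => //; apply: cvgV; rewrite ?normr_eq0 //.
  exact: cvg_norm.
have dp_cvg k : ((fun i => dir (z i 0%N) ^+ k) @ F --> dir (v 0%N) ^+ k)%classic by exact: cvgX.
have x_neq0 : F (fun i => 0 < `|z i 0%N| ^+ 2).
  apply: near_gt0 n_cvg _; first by move=> i; rewrite ger0_real // exprn_ge0.
  by rewrite exprn_gt0 // normr_gt0.
rewrite /g /next_fun (negPf v0).
have [s0|s0] := eqVneq (sqnorm n (fun k => v k.+1)) 0.
  apply: (near_eq (fun i => act (dir (z i 0%N) ^+ (p ^ m')) 1 (qone C))); last first.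
    by apply: qcvg_act => //; exact: qcvg_cst.
  have : F (fun i => 0 < `|z i 0%N| ^+ 2 - sqnorm n (fun k => z i k.+1)).
    apply: (@near_gt0 _ _ _ FF _ (`|v 0%N| ^+ 2 - sqnorm n (fun k => v k.+1))).
    - by move=> i; rewrite rpredB // ger0_real ?sqnorm_ge0 // exprn_ge0.
    - exact: cvgB.
    - by rewrite s0 subr0 exprn_gt0 // normr_gt0.
  apply: filterS2 x_neq0 => i x0; rewrite subr_gt0 => lt_i.
  have {}x0 : z i 0%N != 0 by apply: contraTneq x0 => ->; rewrite normr0 expr0n ltxx.
  rewrite /g /next_fun (negPf x0); case: eqVneq => // si0.
  have [l [j [ln lj]]] := weight_ge3 x0 si0 (ltW lt_i).
  suff -> : steps (f (turn (z i))) (weight n (z i)) n.*2 (t i) = qone C by [].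
  apply: steps_ge3 ln lj => // [|k]; last exact: weight_sparse.
  by apply: (good_hpath fP); rewrite sqnorm_turn.
apply: (near_eq (fun i => act (dir (z i 0%N) ^+ (p ^ m')) 1
    (steps (f (turn (z i))) (weight n (z i)) n.*2 (t i)))).
  have : F (fun i => 0 < sqnorm n (fun k => z i k.+1)).
    apply: near_gt0 s_cvg _; last by rewrite lt0r s0 sqnorm_ge0.
    by move=> i; rewrite ger0_real // sqnorm_ge0.
  apply: filterS2 x_neq0 => i x0 si0.
  have {}x0 : z i 0%N != 0 by apply: contraTneq x0 => ->; rewrite normr0 expr0n ltxx.
  by rewrite /g /next_fun (negPf x0) gt_eqF.
have turn_cvg k : ((fun i => turn (z i) k) @ F --> turn (v) k)%classic.
  apply: cvgM => //; apply: cvgM; last exact: cvg_cst.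
  do 2 apply: cvgX; apply: cvgV => //; exact: dir_neq0.
have ts0 : sqnorm n (turn v) != 0 by rewrite sqnorm_turn.
have gap_cvg l j : ((fun i => gap (wcoord (turn (z i)) l / xi ^+ j)) @ F -->
    gap (wcoord (turn v) l / xi ^+ j))%classic.
  have w_cvg : ((fun i => wcoord (turn (z i)) l / xi ^+ j) @ F --> wcoord (turn v) l / xi ^+ j)%classic.
    by do 2 (apply: cvgM; try exact: cvg_cst).
  apply: cvg_big => [|k _]; first exact: mul_continuous.
  apply: cvg_pospart; apply: cvgB => //.
  by apply: cvgM => //; apply: cvg_cst.
apply: qcvg_act => //.
apply: (@pcvg_steps _ _ _ p_gt0 xi_prim xi1 _ _ FF (fun i => f (turn (z i))) _
   (fun i => weight n (z i)) (weight n v)) => //.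
- by apply: (good_hpath fP).
- by apply: (good_cvg fP).
- move=> l j; apply: cvgM => //; apply: cvgM.
    apply: cvgM; first exact: cvg_cst.
    apply: cvg_pospart; apply: cvgB => //; apply: cvgM => //; exact: cvg_cst.
  apply: cvgV; first by rewrite mulf_neq0 // gapsum_neq0.
  apply: cvgM => //; apply: cvg_big => [|i _]; first exact: add_continuous.
  by apply: cvg_big => [|j' _]; [exact: add_continuous | exact: gap_cvg].
- by move=> i l; exact: weight_sparse.
- by move=> l; exact: weight_sparse.
Qed.

End Next.

Lemma good_exists n : exists m, (n <= m)%N /\ exists f, good n m f.
Proof.
elim: n => [|n [m [nm [f fP]]]].
  (* For [n = 0] the sum [sqnorm] is empty, so no vector is nonzero and all conditions are
     vacuous. *)
  exists 0%N; split => //; exists (fun _ _ => qone C).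
  by split=> [u c v t _ _|v|T F FF z v _]; rewrite /sqnorm big_ord0 eqxx.
exists (m.+1 + 2 * n.*2)%N; split; first by rewrite addSn ltnS (leq_trans nm) ?leq_addr.
exists (next_fun n (m.+1 + 2 * n.*2)%N f); split.
- by move=> *; exact: next_rot.
- by move=> *; exact: next_hpath.
- by move=> *; exact: next_cvg.
Qed.

End Induction.

(** * From complex numbers to pairs of reals *)

Section SphereMap.
Variables (C : numClosedFieldType) (p : nat) (xi : C).
Hypothesis p_gt0 : (0 < p)%N.
Hypothesis xi_prim : p.-primitive_root xi.
Hypothesis xi1 : xi != 1.
Implicit Types q : C * C.

(* The modulus of [|q.1| + i |q.2|] is a square root of [qnorm q] built from continuous maps. *)
Definition qabs q : C := `| `|q.1| + 'i * `|q.2| |.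

Lemma qabs_sqr q : qabs q ^+ 2 = qnorm q.
Proof. by rewrite /qabs normC2_rect ?normr_real // qnormE. Qed.

Lemma qabs_neq0 q : qnorm q != 0 -> qabs q != 0.
Proof. by rewrite -qabs_sqr expf_eq0. Qed.

Definition qunit q : C * C := (q.1 / qabs q, q.2 / qabs q).

Lemma qnorm_unit q : qnorm q != 0 -> qnorm (qunit q) = 1.
Proof.
move=> q0; rewrite qnormE /qunit /= !normrM !normfV [`|qabs q|]normr_id.
by rewrite !exprMn -mulrDl -qnormE exprVn qabs_sqr divff.
Qed.

Lemma qunit_act u c q : `|u| = 1 -> `|c| = 1 -> qunit (act u c q) = act u c (qunit q).
Proof. by move=> u1 c1; rewrite /qunit /qabs /act /= !normrM u1 c1 !mul1r !mulrA. Qed.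

(** Evaluation of the paths at 0, followed by normalisation. Convergence is spelled out by
    inequalities along an arbitrary filter, which can then be instantiated by neighbourhoods for
    [vdist2]. *)
Lemma sphere_map_exists n : exists m, (n <= m)%N /\ exists g : (nat -> C) -> C * C,
  [/\ forall v, sqnorm n v != 0 -> qnorm (g v) = 1,
      forall u c v, `|u| = 1 -> c ^+ p = 1 -> sqnorm n v != 0 ->
        g (vact p u c v) = act (u ^+ (p ^ m)) c (g v) &
      forall (T : Type) (F : set_system T) (FF : Filter F) (z : T -> nat -> C) v,
        (forall k e, 0 < e -> F (fun i => `|v k - z i k| < e)) -> sqnorm n v != 0 ->
        forall e, 0 < e ->
          F (fun i => `|(g v).1 - (g (z i)).1| < e /\ `|(g v).2 - (g (z i)).2| < e)].
Proof.
pose zeta := (p.-root ('i : C))%C.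
have zetaP : zeta ^+ p = 'i by rewrite rootCK.
have [m [nm [f fP]]] := good_exists p_gt0 xi_prim xi1 zetaP n.
exists m; split => //; exists (fun v => qunit (f v 0)); split.
- by move=> v v0; apply: qnorm_unit; case: (good_hpath fP v0).
- move=> u c v u1 cp v0; rewrite (good_rot fP) // qunit_act ?normrX ?u1 ?expr1n //.
  by apply/eqP; rewrite -(@pexpr_eq1 _ _ p) // -normrX cp normr1.
move=> T F FF z v zv v0 e e0.
have fcvg : qcvg F (fun i => f (z i) 0) (f v 0).
  apply: (good_cvg fP FF (z := z) _ v0 (t := fun=> 0)); last exact: cvg_cst.
  by move=> k; apply/cvgrPdist_lt => e' e'0; exact: zv.
have q0 : qnorm (f v 0) != 0 by case: (good_hpath fP v0).
case: fcvg => c1 c2.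
have ca : ((fun i => (qabs (f (z i) 0))^-1) @ F --> (qabs (f v 0))^-1)%classic.
  apply: cvgV; first exact: qabs_neq0.
  apply: cvg_norm; apply: cvgD; first exact: cvg_norm.
  by apply: cvgM; [exact: cvg_cst | exact: cvg_norm].
have h1 : ((fun i => (qunit (f (z i) 0)).1) @ F --> (qunit (f v 0)).1)%classic by exact: cvgM.
have h2 : ((fun i => (qunit (f (z i) 0)).2) @ F --> (qunit (f v 0)).2)%classic by exact: cvgM.
move/cvgrPdist_lt: h1 => /(_ e e0) h1; move/cvgrPdist_lt: h2 => /(_ e e0).
by apply: filterS2 h1 => i h1 h2; split.
Qed.

End SphereMap.

(** * Identification of pairs of reals with [R[i]], and the primitive root of unity *)

Section Transfer.
Variable R : realType.
Implicit Types (a b : cpx R).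
Local Notation C := (R[i]).

Definition toC a : C := Complex a.1 a.2.
Definition ofC (z : C) : cpx R := (complex.Re z, complex.Im z).

Lemma toCK a : ofC (toC a) = a.
Proof. by case: a. Qed.

Lemma ofCK z : toC (ofC z) = z.
Proof. by case: z. Qed.

Lemma toC_mul a b : toC (cmul a b) = toC a * toC b.
Proof. by []. Qed.

Lemma toC_exp a k : toC (cexp a k) = toC a ^+ k.
Proof. by elim: k => [|k IH] //; rewrite exprS -IH. Qed.

Lemma norm_toC a : `|toC a| ^+ 2 = (cnorm2 a)%:C%C.
Proof.
rewrite normc_def /= -rmorphXn /= sqr_sqrtr //.
by rewrite addr_ge0 // sqr_ge0.
Qed.

Lemma toC_rho p k l t i z : toC (rho p k l t i z) = toC t ^+ k * toC (xi R p) ^+ (l * i) * toC z.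
Proof. by rewrite /rho !toC_mul !toC_exp. Qed.

Lemma xi_exp p k : toC (xi R p) ^+ k =
  Complex (cos (k%:R * (2 * pi / p%:R))) (sin (k%:R * (2 * pi / p%:R))).
Proof.
elim: k => [|k IH]; first by rewrite expr0 mul0r cos0 sin0.
rewrite exprS IH; set th := 2 * pi / p%:R.
have -> : k.+1%:R * th = th + k%:R * th by rewrite -[k.+1%:R]natr1; ring.
by rewrite cosD sinD [sin th * _ + _]addrC.
Qed.

Lemma xi_order p : (0 < p)%N -> toC (xi R p) ^+ p = 1.
Proof.
move=> p0; rewrite xi_exp mulrC divfK ?pnatr_eq0 -?lt0n //.
by rewrite mulr_natl cos2pi sin2pi.
Qed.

Lemma xi_neq1 p : (1 < p)%N -> toC (xi R p) != 1.
Proof.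
move=> p1; apply/eqP => -[] c1 _.
have p0 : 0 < p%:R :> R by rewrite ltr0n ltnW.
have t0 : 0 < 2 * pi / p%:R :> R by rewrite divr_gt0 // mulr_gt0 // pi_gt0.
(* Since [2 <= p], the angle lies between 0 and [pi], where the cosine is injective. *)
have : 2 * pi / p%:R = 0 :> R.
  apply: cos_inj; rewrite ?cos0 // in_itv /=; last by rewrite lexx pi_ge0.
  rewrite ltW //= ler_pdivrMr // mulrC ler_pM2l ?pi_gt0 //.
  by rewrite ler_nat.
by move=> e; rewrite e ltxx in t0.
Qed.

Lemma xi_primitive p : prime p -> p.-primitive_root (toC (xi R p)).
Proof.
move=> pp; have p0 := prime_gt0 pp.
have [m mP mp] := prim_order_exists p0 (xi_order p0).
case/primeP: (pp) => _ /(_ m mp)/orP[]/eqP mE; last by rewrite -[X in X.-primitive_root]mE.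
move: mP; rewrite mE => /prim_expr_order; rewrite expr1 => e.
by move: (xi_neq1 (prime_gt1 pp)); rewrite e eqxx.
Qed.

End Transfer.

Unset Implicit Arguments.

Theorem theorem2p1 (R : realType) (p : nat) (hp : prime p) (n : nat) (hn : (1 <= n)%N) :
  exists m : nat, (n <= m)%N /\
    exists f : ('I_n -> cpx R) -> ('I_2 -> cpx R),
      (forall v, in_sphere v -> in_sphere (f v)) /\
      sphere_continuous f /\
      (forall (t : cpx R) (i : nat), cnorm2 t = 1 ->
         forall v, in_sphere v ->
           f (repact p (wV p n) t i v) = repact p (wW p m) t i (f v)).
Proof.
have p0 := prime_gt0 hp.
have [m [nm [g [g_norm g_rot g_cvg]]]] := sphere_map_exists p0 (xi_primitive R hp)
  (xi_neq1 R (prime_gt1 hp)) n.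
exists m; split => //.
(* Padding by zeros beyond index [n]. *)
pose ext (v : 'I_n -> cpx R) k : R[i] := if insub k is Some j then toC (v j) else 0.
have extE v (j : 'I_n) : ext v j = toC (v j) by rewrite /ext valK.
have ext0 v k : (n <= k)%N -> ext v k = 0 by move=> h; rewrite /ext insubF // ltnNge h.
have ext_norm v : sqnorm n (ext v) = (vnorm2 v)%:C%C.
  rewrite /vnorm2 rmorph_sum /=; apply: eq_bigr => j _.
  by rewrite extE norm_toC.
have ext_neq0 v : in_sphere v -> sqnorm n (ext v) != 0.
  by rewrite ext_norm => ->; rewrite oner_eq0.
pose f v (j : 'I_2) := if val j == 0%N then ofC (g (ext v)).1 else ofC (g (ext v)).2.
exists f; split; [|split].
- move=> v /ext_neq0/g_norm; rewrite qnormE => e.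
  rewrite /in_sphere /vnorm2 big_ord_recl big_ord1 /f /=.
  apply: (@complexI R); rewrite rmorphD /= -!norm_toC !ofCK.
  by rewrite e.
- move=> v vS eps eps0.
  (* The filter of sets containing all points of the sphere sufficiently close to [v]. *)
  pose F : set_system ('I_n -> cpx R) := fun A =>
    exists2 del : R, 0 < del & forall u, in_sphere u -> vdist2 u v < del -> A u.
  have FF : Filter F.
    split; first by exists 1.
    - move=> A B [d d0 dA] [e e0 eB]; exists (Num.min d e); first by rewrite lt_min d0.
      by move=> u uS; rewrite lt_min => /andP[ud ue]; split; [exact: dA | exact: eB].
    - by move=> A B AB [d d0 dA]; exists d => // u uS ud; apply: AB; exact: dA.
  have posE (e : R[i]) : 0 < e -> 0 < complex.Re e /\ e = (complex.Re e)%:C%C.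
    by case: e => a b; rewrite ltcE /= => /andP[/eqP b0 a0]; split => //; subst b.
  (* A positive [e] of [R[i]] is real; its square serves as radius because [vdist2] is a squared
     distance. *)
  have ext_cvg k (e : R[i]) : 0 < e -> F (fun u => `|ext v k - ext u k| < e).
    move=> /posE[r0 eE]; exists (complex.Re e ^+ 2); first by rewrite exprn_gt0.
    move=> u _ uv; rewrite distrC.
    have [kn|nk] := ltnP k n; last by rewrite !ext0 // subrr normr0 eE ltcR.
    rewrite -[k]/(val (Ordinal kn)) !extE; set j := Ordinal kn.
    rewrite eE -(ltr_pXn2r (n := 2)) ?nnegrE ?normr_ge0 ?lecR ?(ltW r0) //.
    rewrite (norm_toC ((u j).1 - (v j).1, (u j).2 - (v j).2)) -rmorphXn /= ltcR.
    apply: le_lt_trans uv; rewrite /vdist2 (bigD1 j) //= lerDl.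
    by apply: sumr_ge0 => i _; rewrite addr_ge0 // sqr_ge0.
  (* Each of the two coordinates contributes less than [r ^+ 2 = eps / 2] to the squared
     distance. *)
  pose r := Num.sqrt (eps / 2); have r_gt0 : 0 < r by rewrite sqrtr_gt0 divr_gt0.
  have r2 : r ^+ 2 = eps / 2 by rewrite sqr_sqrtr // ltW // divr_gt0.
  have [|d d0 dP] := g_cvg _ F FF ext (ext v) ext_cvg (ext_neq0 v vS) r%:C%C.
    by rewrite ltcR.
  have small (z w : R[i]) : `|z - w| < r%:C%C ->
      cnorm2 ((ofC w).1 - (ofC z).1, (ofC w).2 - (ofC z).2) < eps / 2.
    move=> zw; rewrite -r2 -ltcR rmorphXn /= -norm_toC.
    have -> : toC ((ofC w).1 - (ofC z).1, (ofC w).2 - (ofC z).2) = w - z by case: z w {zw} => [? ?] [? ?].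
    by rewrite ltr_pXn2r ?nnegrE ?normr_ge0 ?lecR ?(ltW r_gt0) // distrC.
  exists d => // u uS /(dP u uS)[h1 h2].
  rewrite /vdist2 big_ord_recl big_ord1 /f /= [ltRHS]splitr.
  by apply: ltrD; exact: small.
- move=> t i t1 v vS.
  have T1 : `|toC t| = 1.
    by apply/eqP; rewrite -(@pexpr_eq1 _ _ 2) // norm_toC t1.
  have extR : ext (repact p (wV p n) t i v) = vact p (toC t) (toC (xi R p) ^+ i) (ext v).
    apply/funext => k; rewrite /vact; have [kn|nk] := ltnP k n; last by rewrite !ext0 // mulr0.
    by rewrite -[k]/(val (Ordinal kn)) !extE /repact toC_rho mul1n.
  have xiP : (toC (xi R p) ^+ i) ^+ p = 1 by rewrite exprAC xi_order // expr1n.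
  apply/funext => j; rewrite /f /repact extR g_rot ?ext_neq0 // /wW.
  apply: (can_inj (@toCK R)); rewrite !(fun_if (@toC R)) toC_rho !ofCK /act.
  by case: (val j == 0%N) => /=; rewrite ?mul0n ?mul1n ?expr0 ?mulr1 ?mul1r !ofCK.
Qed.
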